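(* For coprime $p,q\in\mathbb N$ with $2p\le q$, let $K_{p,q}^0=\{p,p+1,\ldots,q-p\}$ and $K_{p,q}=\{q\nu+k:\nu\in\mathbb Z,\ \nu\ge 0,\ k\in K_{p,q}^0\}$, and let $\delta(\cdot)$ and $A(\cdot)$ be the extremal quantities defined in the context. Then the following hold. (i) For $p=1$ and every integer $q\ge 2$, \[ \delta(K_{1,q}^0)=\delta(K_{1,q})=A(1/q)=\frac1q . \] (ii) For $p=2$ and every odd integer $q\ge 5$, \[ \delta(K_{2,q}^0)=\delta(K_{2,q})=A(2/q)=\frac{1+\cos(\pi/q)}{q\cos(\pi/q)} . \] (iii) For $p=3$ and every integer $q\ge 7$ not divisible by $3$, \[ \delta(K_{3,q}^0)=\delta(K_{3,q})=A(3/q)=\frac1q\left(1+\frac{1-2\bigl(\cos(2\pi r_0/q)+\cos(2\pi(r_0+1)/q)\bigr)}{1+2\cos(2\pi r_0/q)\cos(2\pi(r_0+1)/q)}\right), \] where $r_0=\lfloor q/3\rfloor$ is the integer part of $q/3$. (iv) For every integer $p\ge 1$ and $q=2p+1$, \[ \delta(K_{p,2p+1}^0)=\delta(K_{p,2p+1})=A\left(\frac{p}{2p+1}\right)=\frac{\cos(\pi/(2p+1))}{1+\cos(\pi/(2p+1))} . \]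
   Context: $\mathbb N=\{1,2,3,\ldots\}$. Definition of $\delta(K)$. For $K\subset\mathbb N$, let $\mathbf T(K)$ be the set of real trigonometric polynomials $T$ such that: (1) $T(x)=T_0+\sum_{k\in K,\ k\le H}T_k\cos(2\pi kx)$ for some $H>1$ (which may depend on $T$) and real coefficients $T_0,T_k$; (2) $T(x)\ge 0$ for all $x\in\mathbb R$; (3) $T(0)=1$. Put \[ \delta(K)=\inf_{T\in\mathbf T(K)}T_0 . \] Definition of $A(h)$ (Turán's problem). For $0<h\le 1/2$, let $K(h)$ be the class of continuous $1$-periodic even functions $f:\mathbb R\to\mathbb R$ such that: (1) $f(x)=\sum_{n=0}^\infty a_n\cos(2\pi nx)$; (2) $a_n\ge 0$ for all $n=0,1,2,\ldots$; (3) $f(0)=\sum_{n=0}^\infty a_n=1$; (4) $f(x)=0$ for $h\le |x|\le 1/2$. Put \[ A(h)=\sup_{f\in K(h)}a_0=\sup_{f\in K(h)}\int_{-h}^{h}f(x)\,dx . \] *)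

(* Defs.v *)
From HB Require Import structures.
From mathcomp Require Import all_boot all_order all_algebra.
From mathcomp Require Import all_classical all_reals all_analysis.

Set Implicit Arguments.
Unset Strict Implicit.
Unset Printing Implicit Defensive.

Import Order.TTheory GRing.Theory Num.Theory.
Import numFieldNormedType.Exports.

Local Open Scope classical_set_scope.
Local Open Scope ring_scope.

(* The sum starts at k = 1 because the frequencies lie in {1, 2, 3, ...};
   the constant coefficient is [c 0]. *)
Definition cos_poly (R : realType) (K : set nat) (H : nat) (c : nat -> R)
    (x : R) : R :=
  c 0%N + \sum_(1 <= k < H.+1 | k \in K) c k * cos (2 * pi * k%:R * x).

Definition admissible_poly (R : realType) (K : set nat) (H : nat)
    (c : nat -> R) : Prop :=
  [/\ (1 < H)%N,
      forall x : R, 0 <= cos_poly K H c x &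
      cos_poly K H c 0 = 1].

(* The set is nonempty (the constant 1 is admissible) and bounded below by 0
   (the mean of a nonnegative polynomial), so the real-valued [inf] is the
   genuine infimum. *)
Definition delta (R : realType) (K : set nat) : R :=
  inf [set t0 : R | exists (H : nat) (c : nat -> R),
                      admissible_poly K H c /\ t0 = c 0%N].
Arguments delta R K : clear implicits.

Definition turan_class (R : realType) (h : R) (f : R -> R) (a : nat -> R) :
    Prop :=
  [/\ continuous f,
      periodic f 1 &
      forall x : R, f (- x) = f x] /\
  [/\ forall x : R,
        series (fun n : nat => a n * cos (2 * pi * n%:R * x)) @ \oo --> f x,
      forall n : nat, 0 <= a n,
      f 0 = 1 &
      forall x : R, h <= `|x| <= 2^-1 -> f x = 0].

(* For 0 < h <= 1/2 the set is nonempty (periodized triangle function of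
   half-width h) and bounded above by 1, so the real-valued [sup] is the
   genuine supremum. *)
Definition turan_A (R : realType) (h : R) : R :=
  sup [set a0 : R | exists (f : R -> R) (a : nat -> R),
                      turan_class h f a /\ a0 = a 0%N].

Definition K0 (p q : nat) : set nat := [set k : nat | (p <= k <= q - p)%N].

Definition Kpq (p q : nat) : set nat :=
  [set n : nat | exists nu k : nat, K0 p q k /\ n = (q * nu + k)%N].

(* Main.v *)
(* Both extremal quantities equal the value of one finite linear program.  If
   mu >= 0 on Z/q has total mass 1 and its Fourier transform vanishes at
   p, ..., q - p, then averaging an admissible T over the points m/q against mu
   gives T_0 = sum_m mu_m T(m/q) >= mu_0.  Conversely, if f is in Turan's class
   and T is admissible, then T_0 = sum_k T_k f(k/q) = sum_n a_n T(n/q) >= a_0,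
   while interpolating the Fourier transform of mu linearly between the points
   j/q produces an f in Turan's class with a_0 = mu_0.  So everything follows
   from a pair (T, mu) with T_0 = mu_0.

   For p <= 3, mu_m is proportional to prod_s (cos(2 pi m/q) - cos(2 pi s/q)),
   s ranging over p - 1 frequencies, and with
   c = cos(2 pi x) the polynomial T is
   (1 - cos(2 pi q x)) L(c) / ((1 - c) prod_s (c - cos(2 pi s/q))^2), where L, of
   degree p - 1, is fixed by the values forced on T at 0 and at the s/q.  For
   q = 2p + 1, mu lives on {0, 1} and T has only the frequencies 0, p, p + 1.

   The Fourier series of the interpolating function comes from
   sum_n cos(2 pi n x)/n^2 = pi^2 (x - 1/2)^2 + const on [0, 1]. *)

Require Import Defs.
From HB Require Import structures.
From mathcomp Require Import all_boot all_order all_algebra.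
From mathcomp Require Import all_classical all_reals all_analysis.
From mathcomp Require Import ring lra zify.

Set Implicit Arguments.
Unset Strict Implicit.
Unset Printing Implicit Defensive.

Import Order.TTheory GRing.Theory Num.Theory.
Import numFieldNormedType.Exports.

Local Open Scope classical_set_scope.
Local Open Scope ring_scope.

(** * Cosines at the lattice points m/q: symmetries and orthogonality *)

Section Lattice.
Variable R : realType.
Implicit Types (x y : R) (q m n k : nat).

Lemma cosDnat2pi x n : cos (x + 2 * pi * n%:R) = cos x.
Proof.
have -> : 2 * pi * n%:R = (pi *+ 2) *+ n :> R by rewrite -[RHS]mulr_natr -[pi *+ 2]mulr_natr; ring.
exact: (periodicn (@cosD2pi R)).
Qed.

Lemma cosM x y : cos x * cos y = (cos (x + y) + cos (x - y)) / 2.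
Proof. by rewrite cosD cosB; field. Qed.

Lemma sinM_cos x y : 2 * sin x * cos y = sin (y + x) - sin (y - x).
Proof. rewrite sinD sinB; ring. Qed.

Definition lcos q n : R := cos (2 * pi * (n%:R / q%:R)).

Lemma lcos0 q : lcos q 0 = 1.
Proof. by rewrite /lcos mul0r mulr0 cos0. Qed.

Lemma lcosDM q m n : (0 < q)%N -> lcos q (m + q * n) = lcos q m.
Proof.
move=> q0; rewrite /lcos -[RHS](cosDnat2pi _ n) natrD natrM; congr cos.
have : q%:R != 0 :> R by rewrite pnatr_eq0 -lt0n.
by move=> ?; field.
Qed.

Lemma lcos_mod q m : (0 < q)%N -> lcos q (m %% q) = lcos q m.
Proof. by move=> q0; rewrite {2}(divn_eq m q) addnC mulnC lcosDM. Qed.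

Lemma lcosB q m : (0 < q)%N -> (m <= q)%N -> lcos q (q - m) = lcos q m.
Proof.
move=> q0 mq; rewrite /lcos -[RHS]cosN -[RHS](cosDnat2pi _ 1) natrB //; congr cos.
have : q%:R != 0 :> R by rewrite pnatr_eq0 -lt0n.
by move=> ?; field.
Qed.

Lemma lcosBM q m j : (0 < q)%N -> (m <= q)%N -> lcos q ((q - m) * j) = lcos q (m * j).
Proof.
move=> q0 mq; rewrite /lcos -[RHS]cosN -[RHS](cosDnat2pi _ j) !natrM natrB //.
congr cos; have : q%:R != 0 :> R by rewrite pnatr_eq0 -lt0n.
by move=> ?; field.
Qed.

(** At least one of the truncated differences [m - n] and [n - m] is 0, so their sum encodes |m -
    n|. *)
Lemma lcosM q m n :
  lcos q m * lcos q n = (lcos q (m + n) + lcos q ((m - n) + (n - m))) / 2.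
Proof.
rewrite /lcos cosM natrD; congr ((cos _ + _) / 2); first by ring.
have [mn|/ltnW mn] := leqP m n.
  rewrite -cosN (eqP mn) add0n natrB //; congr cos; ring.
rewrite (eqP mn) addn0 natrB //; congr cos; ring.
Qed.

Lemma lcos_sqr q m : lcos q m ^+ 2 = (1 + lcos q (m + m)) / 2.
Proof. by rewrite expr2 lcosM subnn lcos0 addrC. Qed.

(** With r = k mod q nonzero, multiplication by 2 sin(pi r/q) > 0 makes the sum telescope, and the
    arguments of the two end terms differ by 2 pi r. *)
Lemma sum_lcos q k : (0 < q)%N ->
  \sum_(0 <= m < q) lcos q (m * k) = if (q %| k)%N then q%:R else 0.
Proof.
move=> q0; have qn0 : q%:R != 0 :> R by rewrite pnatr_eq0 -lt0n.
case: ifPn => [/dvdnP[j ->]|qk].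
  under eq_bigr => m _ do
    rewrite mulnA mulnC -[X in lcos q X]add0n lcosDM // lcos0.
  by rewrite sumr_const_nat subn0.
pose r := (k %% q)%N.
have r0 : (0 < r)%N by rewrite lt0n; move: qk; rewrite /dvdn.
have rq : (r < q)%N by rewrite ltn_mod.
have -> : \sum_(0 <= m < q) lcos q (m * k) = \sum_(0 <= m < q) lcos q (m * r).
  by apply: eq_bigr => m _; rewrite -lcos_mod // -modnMmr lcos_mod.
set h : R := pi * r%:R / q%:R.
have sh : 0 < sin h.
  apply: sin_gt0_pi; rewrite /h divr_gt0 ?mulr_gt0 ?pi_gt0 ?ltr0n//=.
  by rewrite ltr_pdivrMr ?ltr0n// ltr_pM2l ?pi_gt0// ltr_nat.
apply: (mulfI (x := 2 * sin h)); first by rewrite mulf_neq0// gt_eqF.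
rewrite mulr0 mulr_sumr.
pose g m : R := sin ((2 * m%:R - 1) * h).
rewrite (eq_bigr (fun m => g m.+1 - g m)).
  rewrite telescope_sumr // /g mulr0 sub0r mulN1r sinN opprK.
  have -> : (2 * q%:R - 1) * h = - h + (pi *+ 2) *+ r.
    rewrite /h -[(pi *+ 2) *+ r]mulr_natr -[pi *+ 2]mulr_natr; field; exact: qn0.
  by rewrite (periodicn (@sinD2pi R)) sinN addNr.
move=> m _; rewrite /lcos sinM_cos /g; congr (sin _ - sin _).
  rewrite /h natrM -[m.+1%:R]natr1; field; exact: qn0.
rewrite /h natrM; field; exact: qn0.
Qed.

Lemma sum_lcosM q m n : (0 < q)%N ->
  \sum_(0 <= j < q) lcos q (j * m) * lcos q (j * n) =
  ((if (q %| m + n)%N then q%:R else 0) +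
   (if (q %| (m - n) + (n - m))%N then q%:R else 0)) / 2.
Proof.
move=> q0; rewrite -!sum_lcos // -big_split /= mulr_suml; apply: eq_bigr => j _.
by rewrite lcosM -!mulnBr -!mulnDr.
Qed.

Lemma ltr_lcos q m n : (2 * m <= q)%N -> (n < m)%N -> lcos q m < lcos q n.
Proof.
move=> mq nm; have q0 : (0 < q)%N by lia.
have bnd k : (2 * k <= q)%N -> 2 * pi * (k%:R / q%:R) \in `[0, pi : R].
  move=> kq; rewrite in_itv /= mulr_ge0 ?divr_ge0 ?mulr_ge0 ?pi_ge0//=.
  rewrite mulrAC -[leRHS]mul1r ler_wpM2r ?pi_ge0// mulrA ler_pdivrMr ?ltr0n//.
  by rewrite mul1r -natrM ler_nat.
rewrite /lcos ltr_cos ?bnd//; last by lia.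
rewrite ltr_pM2l ?mulr_gt0 ?pi_gt0// ltr_pM2r ?invr_gt0 ?ltr0n//.
by rewrite ltr_nat.
Qed.

Lemma ler_lcos q m n : (2 * m <= q)%N -> (n <= m)%N -> lcos q m <= lcos q n.
Proof.
by move=> mq; rewrite leq_eqVlt => /orP[/eqP->//|/(ltr_lcos mq)/ltW].
Qed.

(** Brings an index into the half period on which [lcos q] decreases; lower bounds and sign checks
    over the whole lattice start from here. *)
Lemma lcos_half q m : (0 < q)%N ->
  exists2 m' : nat, (2 * m' <= q)%N & lcos q m = lcos q m'.
Proof.
move=> q0; rewrite -lcos_mod //; have := ltn_mod m q; rewrite q0.
move: (m %% q)%N => r rq; have [rh|rh] := leqP (2 * r) q; first by exists r.
by exists (q - r)%N; [lia | rewrite lcosB// ltnW].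
Qed.

End Lattice.

(** * Weak duality, and the function in Turan's class built from a dual weight *)

Section Duality.
Variable R : realType.
Implicit Types (x y v : R) (p q m n k H : nat) (c mu : nat -> R).

Lemma cos_lattE q n k : cos (2 * pi * n%:R * (k%:R / q%:R)) = lcos R q (n * k).
Proof. by rewrite /lcos natrM; congr cos; rewrite -!mulrA. Qed.

Lemma cos_poly_latt (K : set nat) H c q m :
  cos_poly K H c (m%:R / q%:R) =
  c 0%N + \sum_(1 <= k < H.+1 | k \in K) c k * lcos R q (m * k).
Proof.
by congr (_ + _); apply: eq_bigr => k _; rewrite cos_lattE mulnC.
Qed.

Lemma K0P p q k : (k \in K0 p q) = (p <= k <= q - p)%N.
Proof. by apply/idP/idP; rewrite inE. Qed.

Lemma K0_sub_Kpq p q : K0 p q `<=` Kpq p q.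
Proof. by move=> k kK; exists 0%N, k; rewrite muln0. Qed.

(** Extension of the coefficients by 0. The index 0 is kept whether or not it lies in K, since the
    constant term is always allowed. *)
Lemma admissible_sub (K K' : set nat) H c : K `<=` K' ->
  admissible_poly K H c ->
  exists2 c', admissible_poly K' H c' & c' 0%N = c 0%N.
Proof.
move=> KK' [H1 T0 T1].
pose c' k := if (k == 0%N) || (k \in K) then c k else 0.
have E x : cos_poly K' H c' x = cos_poly K H c x.
  rewrite /cos_poly {1}/c' eqxx; congr (_ + _).
  rewrite [LHS]big_mkcond [RHS]big_mkcond; apply: eq_big_nat => k /andP[k0 _].
  rewrite /c' gtn_eqF //=; case: (boolP (k \in K)) => kK.
    by move: kK; rewrite !inE => /KK' kK; rewrite ifT // inE.
  by rewrite mul0r if_same.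
by exists c' => //; split=> // [x|]; rewrite E.
Qed.

(** A feasible point of the dual program. Only the cosine transform is constrained, so mu need not
    be symmetric under m -> q - m; for q = 2p + 1 it will sit on 0 and 1 alone. *)
Definition dual_weight p q mu :=
  [/\ forall m, 0 <= mu m,
      \sum_(0 <= m < q) mu m = 1 &
      forall k, (p <= k <= q - p)%N ->
        \sum_(0 <= m < q) mu m * lcos R q (m * k) = 0].

(** On the lattice a frequency of [Kpq] acts like its residue in [K0], so the mu-average of T over
    the points m/q is T_0. As T >= 0, its term m = 0, which is mu_0 T(0), is a lower bound. *)
Lemma cos_poly_ge p q mu H c : (0 < q)%N -> dual_weight p q mu ->
  admissible_poly (Kpq p q) H c -> mu 0%N <= c 0%N.
Proof.
move=> q0 [mu0 mu1 muK] [_ T0 T1].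
have -> : c 0%N = \sum_(0 <= m < q) mu m * cos_poly (Kpq p q) H c (m%:R / q%:R).
  under eq_bigr => m _ do rewrite cos_poly_latt mulrDr mulr_sumr.
  rewrite big_split /= -mulr_suml mu1 mul1r exchange_big /= big1 ?addr0 // => k.
  rewrite inE => -[nu [j [jK ->]]].
  under eq_bigr => m _ do rewrite mulrCA.
  rewrite -mulr_sumr (_ : \sum_(_ <= _ < _) _ = 0) ?mulr0 //.
  rewrite -[RHS](muK j jK); apply: eq_bigr => m _; congr (_ * _).
  by rewrite mulnDr addnC mulnCA lcosDM.
rewrite big_ltn // mul0r T1 mulr1 lerDl.
by apply: sumr_ge0 => m _; rewrite mulr_ge0.
Qed.

Lemma delta_eq (K : set nat) H c v : admissible_poly K H c -> c 0%N = v ->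
  (forall H' c', admissible_poly K H' c' -> v <= c' 0%N) -> delta R K = v.
Proof.
move=> adm c0 lb; apply/le_anti/andP; split.
  apply: ge_inf; first by exists v => _ [H' [c' [/lb ? ->]]].
  by exists H, c; split.
apply: lb_le_inf; first by exists v, H, c; split.
by move=> _ [H' [c' [/lb ? ->]]].
Qed.

(** The support condition only speaks of |x| <= 1/2; a point k/q beyond 1/2 is moved to (q - k)/q by
    evenness and periodicity. *)
Lemma turan_eq0 p q f a k : (0 < q)%N -> turan_class (p%:R / q%:R : R) f a ->
  (p <= k <= q - p)%N -> (p <= q)%N -> f (k%:R / q%:R) = 0.
Proof.
move=> q0 [[_ fper feven] [_ _ _ f0]] kK pq.
have q0R : 0 < q%:R :> R by rewrite ltr0n.
have aux j : (p <= j)%N -> (2 * j <= q)%N -> f (j%:R / q%:R) = 0.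
  move=> pj jq; apply: f0; rewrite ger0_norm ?divr_ge0//.
  rewrite ler_pM2r ?invr_gt0// ler_nat pj /= ler_pdivrMr// mulrC.
  by rewrite ler_pdivlMr// -natrM ler_nat mulnC.
have [kh|kh] := leqP (2 * k) q; first by rewrite aux//; case/andP: kK.
rewrite -feven -fper -[RHS](aux (q - k)%N); try lia.
by congr f; rewrite natrB; last lia; field; rewrite gt_eqF.
Qed.

(** The symmetry of cos(2 pi n k/q) in n and k lets the series of a_n T(n/q) be summed through the
    values f(k/q), all of which vanish for k in [K0]. Its limit is T_0, and every nonempty partial
    sum is at least the first term a_0. *)
Lemma turan_le p q H c f a : (0 < q)%N -> (p <= q)%N ->
  admissible_poly (K0 p q) H c -> turan_class (p%:R / q%:R : R) f a ->
  a 0%N <= c 0%N.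
Proof.
move=> q0 pq [_ T0 T1] cl.
have [_ [fs a0 f01 _]] := cl.
have cv : series (fun n => a n * cos_poly (K0 p q) H c (n%:R / q%:R)) @ \oo -->
    c 0%N * f 0 + \sum_(1 <= k < H.+1 | k \in K0 p q) c k * f (k%:R / q%:R).
  have -> : series (fun n => a n * cos_poly (K0 p q) H c (n%:R / q%:R)) =
      fun N => c 0%N * series (fun n => a n * cos (2 * pi * n%:R * 0)) N +
        \sum_(1 <= k < H.+1 | k \in K0 p q) c k *
          series (fun n => a n * cos (2 * pi * n%:R * (k%:R / q%:R))) N.
    apply/funext => N; rewrite seriesEnat /=.
    under eq_bigr => n _ do rewrite cos_poly_latt mulrDr.
    rewrite big_split /=; congr (_ + _).
      by rewrite mulr_sumr; apply: eq_bigr => n _; rewrite mulr0 cos0 mulr1 mulrC.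
    under eq_bigr => n _ do rewrite mulr_sumr.
    rewrite exchange_big /=; apply: eq_bigr => k _; rewrite mulr_sumr.
    by apply: eq_bigr => n _; rewrite cos_lattE mulrCA.
  apply: cvgD; first by apply: cvgMr; exact: fs.
  apply: cvg_big => [|k _]; first exact: add_continuous.
  by apply: cvgMr; exact: fs.
move: cv; rewrite big1 ?addr0 => [|k]; last first.
  by rewrite K0P => kK; rewrite (turan_eq0 q0 cl) // mulr0.
rewrite f01 mulr1 => cv; apply: (cvgr_to_ge cv).
near=> N; have N0 : (0 < N)%N by near: N; exists 1%N.
rewrite seriesEnat /= big_ltn // mul0r T1 mulr1 lerDl.
by apply: sumr_ge0 => n _; rewrite mulr_ge0.
Unshelve. all: by end_near. Qed.

(* What the Turan side needs from the 1-periodic triangle function of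
   half-width 1/q: its values at 0 and off its support, and the positivity of
   its Fourier coefficients. *)
Definition hat_function q (D : R -> R) (d : nat -> R) :=
  [/\ continuous D, periodic D 1,
      (D 0 = 1 /\ forall x, q%:R^-1 <= x <= 1 - q%:R^-1 -> D x = 0),
      forall x, series (fun n => d n * cos (2 * pi * n%:R * x)) @ \oo --> D x &
      d 0%N = q%:R^-1 /\ forall n, 0 <= d n].

Lemma periodic_subr1 (D : R -> R) : periodic D 1 -> forall x, D (x - 1) = D x.
Proof. by move=> Dp x; rewrite -[LHS]Dp subrK. Qed.

(** The piecewise linear interpolant of the cosine transform F of mu has Fourier coefficients
    proportional to mu, hence nonnegative, and it vanishes where F does. *)
Lemma turan_attained p q mu D d : (0 < p)%N -> (2 * p <= q)%N ->
  dual_weight p q mu -> hat_function q D d ->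
  exists f a, turan_class (p%:R / q%:R : R) f a /\ a 0%N = mu 0%N.
Proof.
move=> p0 pq [mu0 mu1 muK] [Dc Dp [D0 D1] Ds [d0 dge]].
have q0 : (0 < q)%N by lia.
have q0R : 0 < q%:R :> R by rewrite ltr0n.
have qn0 : q%:R != 0 :> R by rewrite gt_eqF.
pose F j : R := \sum_(0 <= m < q) mu m * lcos R q (m * j).
(* Averaging the hats centred at j/q and at -j/q makes f even by construction. *)
pose f x := \sum_(0 <= j < q) F j / 2 * (D (x - j%:R / q%:R) + D (x + j%:R / q%:R)).
(* By orthogonality the inner sum is q/2 times mu_n + mu_(-n), indices taken modulo q; with d_0 =
   1/q this gives a_0 = mu_0. *)
pose a n : R := d n * \sum_(0 <= j < q) F j * lcos R q (n * j).
have De x : D (- x) = D x.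
  apply: (cvg_unique (@Rhausdorff R) (Ds (- x))).
  by under [X in series X]eq_fun => n do rewrite mulrN cosN; exact: Ds.
have F0 : F 0%N = 1.
  by rewrite -mu1; apply: eq_bigr => m _; rewrite muln0 lcos0 mulr1.
have fE x : f (- x) = f x.
  apply: eq_bigr => j _; congr (_ * _); rewrite addrC.
  by congr (_ + _); rewrite -De; congr D; ring.
have fp : periodic f 1.
  move=> x; apply: eq_bigr => j _; congr (_ * _).
  by rewrite addrAC Dp addrAC Dp.
have fser x : series (fun n => a n * cos (2 * pi * n%:R * x)) @ \oo --> f x.
  have -> : series (fun n => a n * cos (2 * pi * n%:R * x)) =
    fun N => \sum_(0 <= j < q) F j / 2 *
     (series (fun n => d n * cos (2 * pi * n%:R * (x - j%:R / q%:R))) N +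
      series (fun n => d n * cos (2 * pi * n%:R * (x + j%:R / q%:R))) N).
    apply/funext => N; rewrite seriesEnat /=.
    under eq_bigr => n _ do rewrite /a mulrAC mulr_sumr.
    rewrite exchange_big /=; apply: eq_bigr => j _.
    rewrite -big_split /= mulr_sumr; apply: eq_bigr => n _.
    rewrite -cos_lattE mulrBr cosB (mulrDr (2 * pi * n%:R)) cosD; by field.
  rewrite /f; apply: cvg_big => [|j _]; first exact: add_continuous.
  by apply: cvgMr; apply: cvgD; exact: Ds.
exists f, a; split; last first.
  rewrite /a d0; under eq_bigr => j _ do rewrite mul0n lcos0 mulr1 /F.
  rewrite exchange_big /= big_ltn // [X in _ + X]big1_seq => [|m].
    rewrite addr0 -mulr_sumr.
    under eq_bigr => j _ do rewrite mul0n lcos0.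
    by rewrite sumr_const_nat subn0 mulrCA mulVf ?mulr1.
  rewrite mem_index_iota /= => mq; rewrite -mulr_sumr.
  under eq_bigr => j _ do rewrite mulnC.
  rewrite sum_lcos // gtnNdvd ?mulr0 //; lia.
split; [split=> // x|split=> // [n||x /andP[x1 x2]]].
- rewrite /f; apply: cvg_big => [|j _]; first exact: add_continuous.
  apply: cvgMr; apply: cvgD; (apply: continuous_comp; last exact: Dc).
    by apply: cvgB => //; exact: cvg_cst.
  by apply: cvgD => //; exact: cvg_cst.
- rewrite /a mulr_ge0 //.
  under eq_bigr => j _ do rewrite /F mulr_suml.
  rewrite exchange_big /=; apply: sumr_ge0 => m _.
  under eq_bigr => j _ do rewrite -mulrA (mulnC m) (mulnC n).
  rewrite -mulr_sumr mulr_ge0 // sum_lcosM // divr_ge0 // addr_ge0 //.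
    by case: ifP.
  by case: ifP.
- rewrite /f big_ltn // mul0r subr0 addr0 D0 F0 big1_seq => [|j].
    by rewrite addr0; field.
  rewrite mem_index_iota /= => /andP[j1 jq].
  have Dj : D (j%:R / q%:R) = 0.
    have i0 : 0 < q%:R^-1 :> R by rewrite invr_gt0.
    apply: D1; rewrite ler_peMl ?ler1n ?(ltW i0) //= lerBrDr -[X in _ + X]mul1r -mulrDl.
    by rewrite natr1 -[leRHS](divff qn0) ler_pM2r // ler_nat.
  by rewrite sub0r De add0r Dj addr0 mulr0.
- rewrite (_ : f x = f `|x|); last by case: ger0P.
  move: `|x| x1 x2 => {}x x1 x2; apply: big1_seq => j.
  rewrite mem_index_iota /= => jq.
  (* Either F j = 0, or j/q is within (p - 1)/q of an integer; in the second case x is at distance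
     at least 1/q from j/q and -j/q modulo 1, so both hats vanish. *)
  have [jK|jK] := boolP (p <= j <= q - p)%N; first by rewrite /F muK // !mul0r.
  set i := q%:R^-1 in x1 D1 *.
  have i0 : 0 < i by rewrite invr_gt0.
  have iq : q%:R * i = 1 by rewrite divff.
  have pi1 : p%:R * i <= 2^-1.
    rewrite -ler_pdivlMr // invrK mulrC ler_pdivlMr // -natrM ler_nat; lia.
  have i2 : i <= 2^-1.
    apply: le_trans pi1; rewrite ler_peMl ?ler1n ?(ltW i0) //.
  have j0 : 0 <= j%:R * i by rewrite mulr_ge0 // ltW.
  have jq1 : j%:R * i + i <= 1.
    by rewrite -[X in _ + X]mul1r -mulrDl natr1 -[leRHS]iq ler_pM2r // ler_nat.
  have pj m n : (m <= n)%N -> m%:R * i <= n%:R * i.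
    by move=> mn; rewrite ler_pM2r // ler_nat.
  move: jK; rewrite negb_and -ltnNge -ltnNge => /orP[/pj|jp].
    rewrite -natr1 mulrDl mul1r => jp; rewrite !D1 ?addr0 ?mulr0 //.
      by apply/andP; split; lra.
    by apply/andP; split; lra.
  have {}jp : 1 + i <= j%:R * i + p%:R * i.
    rewrite -mulrDl -natrD -[X in X + _ <= _]iq -[X in _ + X <= _]mul1r -mulrDl natr1 pj //; lia.
  rewrite -(Dp (x - _)) -(periodic_subr1 Dp (x + _)) !D1 ?addr0 ?mulr0 //.
    by apply/andP; split; lra.
  by apply/andP; split; lra.
Unshelve. all: by end_near. Qed.

(** The lower bound v holds on the larger set [Kpq] while the minimizer already lives on [K0], so
    both infima equal v. The same T bounds Turan's supremum, and the interpolant of mu attains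
    it. *)
Lemma extremal_values p q H c mu v D d : (0 < p)%N -> (2 * p <= q)%N ->
  hat_function q D d -> dual_weight p q mu -> mu 0%N = v ->
  admissible_poly (K0 p q) H c -> c 0%N = v ->
  [/\ delta R (K0 p q) = v, delta R (Kpq p q) = v &
      turan_A (p%:R / q%:R : R) = v].
Proof.
move=> p0 pq Dh muh muv adm cv; have q0 : (0 < q)%N by lia.
have lb H' c' : admissible_poly (Kpq p q) H' c' -> v <= c' 0%N.
  by rewrite -muv; exact: cos_poly_ge.
have [c1 adm1 c1v] := admissible_sub (@K0_sub_Kpq p q) adm.
split.
- apply: (delta_eq adm cv) => H' c' /(admissible_sub (@K0_sub_Kpq p q)).
  by move=> [c2 /lb + <-].
- by apply: (delta_eq adm1) lb; rewrite c1v.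
- have [f [a [fa a0]]] := turan_attained p0 pq muh Dh.
  have ub : ubound [set a0 | exists (f : R -> R) (a : nat -> R),
      turan_class (p%:R / q%:R) f a /\ a0 = a 0%N] v.
    move=> _ [g [b [gb ->]]]; rewrite -cv; apply: turan_le adm gb => //; lia.
  have vin : [set a0 | exists (f : R -> R) (a : nat -> R),
      turan_class (p%:R / q%:R) f a /\ a0 = a 0%N] v.
    by exists f, a; rewrite a0 muv.
  apply/le_anti/andP; split; first by apply: ge_sup => //; exists v.
  by apply: ub_le_sup => //; exists v.
Qed.

End Duality.

(** * Continuity of normally convergent series of functions *)

Section WeierstrassTest.
Variable R : realType.
Variables (u : nat -> R -> R) (b : nat -> R).
Hypothesis ub : forall n x, `|u n x| <= b n.
Hypothesis bcvg : cvgn (series b).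
Hypothesis ucont : forall n, continuous (u n).

Let b0 n : 0 <= b n. Proof. exact: le_trans (ub n 0). Qed.

Lemma normal_series_cvg x : cvgn (series (u ^~ x)).
Proof. by apply: normed_cvg; apply: series_le_cvg bcvg => //= n; exact: ub. Qed.

Lemma normal_series_tail x N :
  `|limn (series (u ^~ x)) - series (u ^~ x) N| <= limn (series b) - series b N.
Proof.
have cv : (fun M => `|series (u ^~ x) M - series (u ^~ x) N|) @ \oo -->
    `|limn (series (u ^~ x)) - series (u ^~ x) N|.
  apply: cvg_norm; apply: cvgB; [exact: normal_series_cvg | exact: cvg_cst].
apply: (cvgr_to_le cv); near=> M.
have NM : (N <= M)%N by near: M; exists N.
rewrite sub_series_geq //; apply: le_trans (ler_norm_sum _ _ _) _.
have : series b M <= limn (series b).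
  by apply: nondecreasing_cvgn_le bcvg _; exact: nondecreasing_series.
rewrite -(lerD2r (- series b N)) sub_series_geq //; apply: le_trans.
by apply: ler_sum => n _; exact: ub.
Unshelve. all: by end_near. Qed.

Lemma normal_series_continuous : continuous (fun x => limn (series (u ^~ x))).
Proof.
move=> x; apply/cvgrPdist_lt => e e0.
have e3 : 0 < e / 3 by rewrite divr_gt0.
have [N _ /(_ N (leqnn N)) /= bN] : \forall N \near \oo,
    limn (series b) - series b N < e / 3.
  have /cvgrPdist_lt/(_ _ e3) := bcvg; apply: filterS => N /=.
  exact: le_lt_trans (ler_norm _).
have cN : {for x, continuous (fun y => series (u ^~ y) N)}.
  rewrite /series /=; apply: cvg_big => [|n _]; first exact: add_continuous.
  exact: ucont.
have /cvgrPdist_lt/(_ _ e3) := cN; apply: filterS => y /= sN.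
have := normal_series_tail x N; have := normal_series_tail y N.
rewrite !ler_norml => /andP[? ?] /andP[? ?].
by move: sN; rewrite !ltr_norml => /andP[? ?]; apply/andP; split; lra.
Qed.

End WeierstrassTest.

(** * The sum of cos(2 pi n x)/n^2 and the triangle function *)

Section SumCosDivSquares.
Variable R : realType.
Implicit Types (x t : R) (n N : nat).

Lemma cvg_series_inv_sqr : cvgn (series (fun n => (n%:R ^+ 2)^-1 : R)).
Proof.
apply: nondecreasing_is_cvgn.
  by apply: nondecreasing_series => n _ _; rewrite invr_ge0 exprn_ge0.
(* Telescoping: 1/(n + 1)^2 <= 1/n - 1/(n + 1). The sum runs over n = 0, ..., N + 1, and its term n
   = 0 is 0 because 0^-1 = 0. *)
have B N : series (fun n => (n%:R ^+ 2)^-1 : R) N.+2 <= 2 - N.+1%:R^-1.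
  elim: N => [|N IH].
    rewrite /series /= big_nat_recr //= big_nat1 expr0n invr0 expr1n invr1; lra.
  rewrite seriesSr.
  apply: le_trans (lerD IH (lexx _)) _.
  have n0 : 0 < N.+1%:R :> R by rewrite ltr0n.
  rewrite -[N.+2%:R]natr1; move: (N.+1%:R : R) n0 => y y0.
  have -> : 2 - (y + 1)^-1 = 2 - y^-1 + (y * (y + 1))^-1.
    by field; rewrite !gt_eqF // addr_gt0.
  rewrite lerD2l lef_pV2 ?posrE ?exprn_gt0 ?mulr_gt0 ?addr_gt0 //; nra.
exists 2 => _ [N _ <-].
apply: (le_trans (y := series (fun n => (n%:R ^+ 2)^-1 : R) N.+2)).
  apply: (nondecreasing_series (P := xpredT)) => [n _ _|]; last by lia.
  by rewrite invr_ge0 exprn_ge0.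
by apply: le_trans (B N) _; rewrite lerBlDr lerDl invr_ge0.
Qed.

Lemma is_derive_mull (a t : R) : is_derive t 1 ( *%R a) a.
Proof.
by apply: is_derive_eq (is_deriveZ a (is_derive_id t 1)) _; rewrite /= -[RHS]mulr1.
Qed.

Lemma is_derive_cosM (a t : R) :
  is_derive t 1 (fun t => cos (a * t)) (- (a * sin (a * t))).
Proof.
apply: is_derive_eq (is_derive1_comp (is_derive_cos _) (is_derive_mull a t)) _.
ring.
Qed.

Lemma is_derive_sinM (a t : R) :
  is_derive t 1 (fun t => sin (a * t)) (a * cos (a * t)).
Proof.
apply: is_derive_eq (is_derive1_comp (is_derive_sin _) (is_derive_mull a t)) _.
ring.
Qed.

Lemma is_derive_series (u du : nat -> R -> R) t N :
  (forall n, is_derive t 1 (u n) (du n t)) ->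
  is_derive t 1 (fun t => series (u ^~ t) N) (series (du ^~ t) N).
Proof.
move=> udu; elim: N => [|N IH].
  rewrite (_ : (fun t => _) = cst 0); last first.
    by apply/funext => y; rewrite /series /= big_geq.
  by rewrite /series /= big_geq //; exact: is_derive_cst.
rewrite (_ : (fun t => _) = (fun t => series (u ^~ t) N) + u N); last first.
  by apply/funext => y; rewrite /series /= big_nat_recr.
by rewrite /series /= big_nat_recr //; exact: is_deriveD.
Qed.

(* The term n = 0 vanishes, because 0^-1 = 0. *)
Definition cosq n t : R := (n%:R ^+ 2)^-1 * cos (2 * pi * n%:R * t).

(** The Dirichlet kernel without its constant term, cleared of the denominator. *)
Lemma sum_cos_cosecant N t :
  series (fun n => 2 * cos (2 * pi * n.+1%:R * t)) N * sin (pi * t) =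
  sin ((2 * N%:R + 1) * pi * t) - sin (pi * t).
Proof.
elim: N => [|N IH].
  by rewrite /series /= big_geq // mul0r mulr0 add0r mul1r subrr.
rewrite seriesSr mulrDl IH.
rewrite (mulrAC 2 (cos _)) sinM_cos.
have -> : 2 * pi * N.+1%:R * t + pi * t = (2 * N.+1%:R + 1) * pi * t by ring.
have -> : 2 * pi * N.+1%:R * t - pi * t = (2 * N%:R + 1) * pi * t.
  by rewrite -[N.+1%:R]natr1; ring.
ring.
Qed.


Definition dcosq n t : R :=
  (n%:R ^+ 2)^-1 * - (2 * pi * n%:R * sin (2 * pi * n%:R * t)).

Lemma is_derive_cosq n t : is_derive t 1 (cosq n) (dcosq n t).
Proof. exact: is_deriveZ (is_derive_cosM _ _). Qed.

Definition ddcosq n t : R :=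
  (n%:R ^+ 2)^-1 * - (2 * pi * n%:R * (2 * pi * n%:R * cos (2 * pi * n%:R * t))).

Lemma is_derive_dcosq n t : is_derive t 1 (dcosq n) (ddcosq n t).
Proof.
apply: (is_deriveZ (n%:R ^+ 2)^-1); apply: is_deriveN.
exact: is_deriveZ (is_derive_sinM _ _).
Qed.

Lemma is_derive_parabola (a b t : R) :
  is_derive t 1 (fun t => a * (t - b) ^+ 2) (a * (2 * (t - b))).
Proof.
apply: is_deriveZ.
apply: is_derive_eq (is_deriveX 2 (is_deriveB (is_derive_id _ _) (is_derive_cst b _ _))) _.
by rewrite /= subr0 expr1 /GRing.scale /= mulr1.
Qed.

Lemma is_derive_line (a b t : R) : is_derive t 1 (fun t => a * (t - b)) a.
Proof.
apply: is_derive_eq (is_deriveZ a (is_deriveB (is_derive_id _ _) (is_derive_cst b _ _))) _.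
by rewrite subr0 /GRing.scale /= mulr1.
Qed.

Lemma is_derive_cos_cosecant (a b t : R) : sin (b * t) != 0 ->
  is_derive t 1 (fun t => cos (a * t) / sin (b * t))
   (- (a * sin (a * t) / sin (b * t)) - b * cos (a * t) * cos (b * t) / sin (b * t) ^+ 2).
Proof.
move=> s0.
apply: is_derive_eq (is_deriveM (is_derive_cosM a t) (is_deriveV s0 (is_derive_sinM b t))) _.
rewrite /GRing.scale /=; field; exact: s0.
Qed.

(** * Rate of convergence of the partial sums on (0, 1/2] *)

Section HalfPeriod.
Variable N : nat.
Let M : R := 2 * N%:R + 1.

Let M0 : 0 < M.
Proof. by rewrite /M ltr_wpDl ?mulr_ge0. Qed.

Definition dcosq_defect t := series (dcosq ^~ t) N.+1 - 2 * pi ^+ 2 * (t - 2^-1).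

(** Differentiating twice cancels the factor 1/n^2, and the second derivative 2 pi^2 of the parabola
    supplies the constant term of the Dirichlet kernel. *)
Lemma is_derive_dcosq_defect t : sin (pi * t) != 0 ->
  is_derive t 1 dcosq_defect (- (2 * pi ^+ 2 * (sin (M * pi * t) / sin (pi * t)))).
Proof.
move=> s0.
apply: is_derive_eq (is_deriveB (@is_derive_series dcosq ddcosq t N.+1 (is_derive_dcosq ^~ t))
  (is_derive_line _ _ _)) _.
rewrite seriesEnat /= big_nat_recl // {1}/ddcosq mulr0n expr0n invr0 mul0r add0r.
rewrite (eq_bigr (fun n => - (2 * pi ^+ 2) * (2 * cos (2 * pi * n.+1%:R * t)))).
  rewrite -mulr_sumr -[X in _ * X](mulfK s0).
  have := sum_cos_cosecant N t; rewrite seriesEnat /= => ->.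
  by rewrite /M; field.
move=> n _; rewrite /ddcosq; field; by rewrite nat1r pnatr_eq0.
Qed.

(* The added term integrates the oscillating factor of the derivative of [dcosq_defect],
   so that only a derivative of order 1/N is left. *)
Definition dcosq_corrected t := dcosq_defect t - 2 * pi / M * (cos (M * pi * t) / sin (pi * t)).

Lemma is_derive_dcosq_corrected t : sin (pi * t) != 0 ->
  is_derive t 1 dcosq_corrected
    (2 * pi ^+ 2 / M * (cos (M * pi * t) * cos (pi * t) / sin (pi * t) ^+ 2)).
Proof.
move=> s0.
apply: is_derive_eq (is_deriveB (is_derive_dcosq_defect s0)
  (is_deriveZ (2 * pi / M) (is_derive_cos_cosecant (M * pi) s0))) _.
rewrite /GRing.scale /=; field; rewrite s0 /= gt_eqF //.
Qed.

Lemma sin_half_period n : sin (2 * pi * n%:R * 2^-1) = 0 :> R.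
Proof.
elim: n => [|n IH]; first by rewrite mulr0 mul0r sin0.
rewrite (_ : _ * _ = 2 * pi * n%:R * 2^-1 + pi); first by rewrite sinDpi IH oppr0.
by rewrite -natr1; field.
Qed.

Lemma cos_odd_quarter : cos (M * pi * 2^-1) = 0.
Proof.
rewrite (_ : _ * _ = 2 * pi * N%:R * 2^-1 + pi / 2); last by rewrite /M; field.
by rewrite cosDpihalf sin_half_period oppr0.
Qed.

(** Base point of the mean value argument: at 1/2 every sine vanishes, and so does the correction
    because M is odd. *)
Lemma dcosq_corrected_half : dcosq_corrected 2^-1 = 0.
Proof.
rewrite /dcosq_corrected cos_odd_quarter mul0r mulr0 subr0 /dcosq_defect subrr mulr0 subr0.
rewrite seriesEnat /=; apply: big1 => n _.
by rewrite /dcosq sin_half_period mulr0 oppr0 mulr0.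
Qed.

Lemma sin_pi_mono x t : 0 < x -> x <= t <= 2^-1 -> 0 < sin (pi * x) <= sin (pi * t).
Proof.
move=> x0 /andP[xt t2]; have pi0 := pi_gt0 R.
have x2 : x <= 2^-1 by exact: le_trans t2.
apply/andP; split.
  by apply: sin_gt0_pi; rewrite mulr_gt0 //= -[ltRHS]mulr1 ltr_pM2l //; lra.
rewrite leNgt ltr_sin ?ltr_pM2l // -?leNgt // in_itv /=.
  by apply/andP; split; nra.
by apply/andP; split; nra.
Qed.

(** Mean value theorem between t and the zero 1/2: the derivative carries a factor 1/M, and sin(pi
    y) >= sin(pi x) on [t, 1/2]. *)
Lemma dcosq_corrected_bound x t : 0 < x -> x <= t <= 2^-1 ->
  `|dcosq_corrected t| <= (pi / sin (pi * x)) ^+ 2 / M.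
Proof.
move=> x0 xt; have pi0 := pi_gt0 R.
have s0 y : y \in `[t, 2^-1] -> 0 < sin (pi * x) <= sin (pi * y).
  by rewrite in_itv /= => /andP[ty y2]; apply: sin_pi_mono => //; lra.
pose dk y := 2 * pi ^+ 2 / M * (cos (M * pi * y) * cos (pi * y) / sin (pi * y) ^+ 2).
have dkE y : y \in `[t, 2^-1] -> is_derive y 1 dcosq_corrected (dk y).
  move=> /s0/andP[sx sy]; apply: is_derive_dcosq_corrected.
  by rewrite gt_eqF //; exact: lt_le_trans sy.
have dkO y : y \in `]t, 2^-1[ -> is_derive y 1 dcosq_corrected (dk y).
  by move=> /subset_itv_oo_cc; exact: dkE.
have kc : {within `[t, 2^-1], continuous dcosq_corrected}.
  by apply: derivable_within_continuous => y /dkE [].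
have [c /s0/andP[sx sc] E] := @MVT_segment R dcosq_corrected dk t 2^-1 (andP xt).2 dkO kc.
rewrite /dk in E.
rewrite -normrN -[- _]add0r -dcosq_corrected_half E !normrM.
have -> : `|2^-1 - t| = 2^-1 - t by rewrite ger0_norm //; lra.
have -> : `|2 : R| = 2 by rewrite ger0_norm.
rewrite !normfV !normrX (ger0_norm (ltW M0)) (ger0_norm (ltW pi0)).
have -> : `|sin (pi * c)| = sin (pi * c) by rewrite ger0_norm // (le_trans (ltW sx)).
have c1 := cos_max (M * pi * c); have c2 := cos_max (pi * c).
move: (`|cos (M * pi * c)|) (`|cos (pi * c)|) c1 c2 (normr_ge0 (cos (M * pi * c)))
  (normr_ge0 (cos (pi * c))) => a b a1 b1 a0 b0.
have -> : 2 * pi ^+ 2 / M * (a * b / sin (pi * c) ^+ 2) * (2^-1 - t) =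
   (pi ^+ 2 / M) * ((2 * (2^-1 - t)) * (a * b) / sin (pi * c) ^+ 2).
  by field; rewrite !gt_eqF // (lt_le_trans sx).
have -> : (pi / sin (pi * x)) ^+ 2 / M = pi ^+ 2 / M * (1 / sin (pi * x) ^+ 2).
  by field; rewrite !gt_eqF.
rewrite ler_wpM2l ?divr_ge0 ?exprn_ge0 ?(ltW M0) ?(ltW pi0) //.
have ab : 0 <= a * b <= 1 by rewrite mulr_ge0 // mulr_ile1.
have sc0 := lt_le_trans sx sc.
have /andP[ab0 ab1] : 0 <= 2 * (2^-1 - t) * (a * b) <= 1.
  by apply/andP; split; [rewrite mulr_ge0 //; lra | nra].
apply: ler_pM => //; first by rewrite invr_ge0 exprn_ge0 // ltW.
by rewrite lef_pV2 ?posrE ?exprn_gt0 // lerXn2r ?nnegrE ?(ltW sx) ?(ltW sc0).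
Qed.

Lemma dcosq_defect_bound x t : 0 < x -> x <= t <= 2^-1 ->
  `|dcosq_defect t| <= ((pi / sin (pi * x)) ^+ 2 + 2 * (pi / sin (pi * x))) / M.
Proof.
move=> x0 xt; have pi0 := pi_gt0 R; have /andP[sx st] := sin_pi_mono x0 xt.
have -> : dcosq_defect t = dcosq_corrected t + 2 * pi / M * (cos (M * pi * t) / sin (pi * t)).
  by rewrite /dcosq_corrected subrK.
apply: le_trans (ler_normD _ _) _; rewrite [leRHS]mulrDl lerD ?dcosq_corrected_bound //.
rewrite !normrM !normfV (ger0_norm (ltW M0)) (ger0_norm (ltW pi0)).
rewrite (ger0_norm (ltW (lt_le_trans sx st))) (ger0_norm (ler0n R 2)).
have -> : 2 * (pi / sin (pi * x)) / M = 2 * pi / M * (1 / sin (pi * x)).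
  by field; rewrite !gt_eqF.
have st0 := lt_le_trans sx st.
rewrite ler_wpM2l ?divr_ge0 ?mulr_ge0 ?(ltW M0) ?(ltW pi0) //.
rewrite ler_pM ?invr_ge0 ?cos_max ?(ltW st0) //.
by rewrite lef_pV2 ?posrE.
Qed.

Definition cosq_defect t := series (cosq ^~ t) N.+1 - pi ^+ 2 * (t - 2^-1) ^+ 2.

(** Mean value theorem again, now with derivative [dcosq_defect]; M >= N + 1 turns the bound into a
    multiple of the harmonic sequence. *)
Lemma cosq_defect_bound x : 0 < x -> x <= 2^-1 ->
  `|cosq_defect 2^-1 - cosq_defect x| <=
    ((pi / sin (pi * x)) ^+ 2 + 2 * (pi / sin (pi * x))) / N.+1%:R.
Proof.
move=> x0 x2.
have dphiE (y : R) : is_derive y 1 cosq_defect (dcosq_defect y).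
  apply: is_derive_eq (is_deriveB (@is_derive_series cosq dcosq y N.+1 (is_derive_cosq ^~ y))
    (is_derive_parabola _ _ _)) _.
  by rewrite /dcosq_defect; ring.
have pc : {within `[x, 2^-1], continuous cosq_defect}.
  by apply: derivable_within_continuous => y _; case: (dphiE y).
have [c cx ->] := @MVT_segment R cosq_defect dcosq_defect x 2^-1 x2 (fun y _ => dphiE y) pc.
have /andP[sx _] := sin_pi_mono x0 (introT andP (conj (lexx x) x2)).
have pi0 := pi_gt0 R.
rewrite normrM (ger0_norm (x := 2^-1 - x)); last by lra.
have B := dcosq_defect_bound x0 cx.
apply: (le_trans (y := `|dcosq_defect c| * 1)); first by rewrite ler_wpM2l //; lra.
rewrite mulr1; apply: le_trans B _; rewrite ler_wpM2l //.
  have z0 : 0 <= pi / sin (pi * x) by rewrite divr_ge0 ?(ltW pi0) ?(ltW sx).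
  by apply: addr_ge0; [exact: exprn_ge0 | exact: mulr_ge0].
rewrite lef_pV2 ?posrE ?ltr0n // /M -natr1 lerD2r.
by rewrite ler_peMl // ler1n.
Qed.

End HalfPeriod.

Definition cosq_sum x : R := limn (series (cosq ^~ x)).

Let cosq_le n x : `|cosq n x| <= (n%:R ^+ 2)^-1.
Proof.
have n0 : 0 <= (n%:R ^+ 2)^-1 :> R by rewrite invr_ge0 exprn_ge0.
by rewrite normrM ger0_norm // -[leRHS]mulr1 ler_wpM2l // cos_max.
Qed.

Lemma cosq_sum_cvg x : series (cosq ^~ x) @ \oo --> cosq_sum x.
Proof. exact: normal_series_cvg cosq_le cvg_series_inv_sqr x. Qed.

Lemma cosq_sum_continuous : continuous cosq_sum.
Proof.
apply: normal_series_continuous cosq_le cvg_series_inv_sqr _ => n x.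
apply/differentiable_continuous/derivable1_diffP.
by case: (is_derive_cosq n x).
Qed.

Lemma cosq_sumN x : cosq_sum (- x) = cosq_sum x.
Proof.
rewrite /cosq_sum; congr (limn (series _)); apply/funext => n.
by rewrite /cosq mulrN cosN.
Qed.

Lemma cosq_sumD1 x : cosq_sum (x + 1) = cosq_sum x.
Proof.
rewrite /cosq_sum; congr (limn (series _)); apply/funext => n.
by rewrite /cosq mulrDr mulr1 cosDnat2pi.
Qed.

(** For fixed x the defects at x and at 1/2 differ by O(1/N), so they have the same limit. *)
Lemma cosq_sum_half x : 0 < x -> x <= 2^-1 ->
  cosq_sum x = cosq_sum 2^-1 + pi ^+ 2 * (x - 2^-1) ^+ 2.
Proof.
move=> x0 x2; set C := (pi / sin (pi * x)) ^+ 2 + 2 * (pi / sin (pi * x)).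
have cosq_defect_cvg y : (fun N => cosq_defect N y) @ \oo -->
    cosq_sum y - pi ^+ 2 * (y - 2^-1) ^+ 2.
  apply: cvgB; last exact: cvg_cst.
  by rewrite (cvg_shiftS (series (cosq ^~ y))); exact: cosq_sum_cvg.
have L0 : (fun N => `|cosq_defect N 2^-1 - cosq_defect N x|) @ \oo --> (0 : R).
  apply: (squeeze_cvgr (f := cst 0) (h := fun N => C * harmonic N)).
  - by apply: nearW => N; rewrite /= normr_ge0 cosq_defect_bound.
  - exact: cvg_cst.
  - by rewrite -[X in _ --> X](mulr0 C); apply: cvgMr; exact: cvg_harmonic.
pose d := cosq_sum 2^-1 - pi ^+ 2 * (2^-1 - 2^-1) ^+ 2 -
  (cosq_sum x - pi ^+ 2 * (x - 2^-1) ^+ 2).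
have E0 : (fun N => `|cosq_defect N 2^-1 - cosq_defect N x|) @ \oo --> `|d|.
  by apply: cvg_norm; apply: cvgB; exact: cosq_defect_cvg.
have /eqP : `|d| = 0 by exact: (cvg_unique (@Rhausdorff R) E0 L0).
rewrite /d normr_eq0 subrr expr0n mulr0 subr0 => /eqP E.
by apply/eqP; rewrite -subr_eq0 -oppr_eq0 -E; apply/eqP; ring.
Qed.

(* The second Bernoulli polynomial, with an undetermined additive constant that
   cancels in second differences. *)
Lemma cosq_sumE x : 0 <= x <= 1 ->
  cosq_sum x = cosq_sum 2^-1 + pi ^+ 2 * (x - 2^-1) ^+ 2.
Proof.
(* The bound degenerates at x = 0, which is reached by continuity along [harmonic n.+1] = 1/(n + 2),
   a sequence in (0, 1/2]. *)
have S0 : cosq_sum 0 = cosq_sum 2^-1 + pi ^+ 2 * (0 - 2^-1) ^+ 2.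
  have h0 : harmonic n.+1 @[n --> \oo] --> (0 : R).
    by rewrite (cvg_shiftS (@harmonic R : nat -> R)); exact: cvg_harmonic.
  have c1 : cosq_sum (harmonic n.+1) @[n --> \oo] --> cosq_sum 0.
    apply: (@cvg_comp _ _ _ (fun n => harmonic n.+1) cosq_sum _ (nbhs (0 : R))).
      exact: h0.
    exact: cosq_sum_continuous.
  have c2 : cosq_sum (harmonic n.+1) @[n --> \oo] -->
      cosq_sum 2^-1 + pi ^+ 2 * ((0 - 2^-1) * (0 - 2^-1)).
    have -> : (fun n => cosq_sum (harmonic n.+1)) = (fun n => cosq_sum 2^-1 +
        pi ^+ 2 * ((harmonic n.+1 - 2^-1) * (harmonic n.+1 - 2^-1))).
      apply/funext => n; rewrite -expr2 cosq_sum_half ?harmonic_gt0 //.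
      by rewrite /harmonic /= lef_pV2 ?posrE ?ltr0n // ler_nat.
    apply: cvgD; first exact: cvg_cst.
    by apply: cvgMr; apply: cvgM; (apply: cvgB; [exact: h0 | exact: cvg_cst]).
  by rewrite expr2; exact: (cvg_unique (@Rhausdorff R) c1 c2).
have Sh y : 0 <= y -> y <= 2^-1 ->
    cosq_sum y = cosq_sum 2^-1 + pi ^+ 2 * (y - 2^-1) ^+ 2.
  rewrite le_eqVlt => /orP[/eqP <- //|]; exact: cosq_sum_half.
move=> /andP[x0 x1]; have [x2|x2] := lerP x 2^-1; first exact: Sh.
(* Reflection x -> 1 - x, which preserves the parabola. *)
by rewrite -cosq_sumN -cosq_sumD1 Sh; lra.
Qed.

(** A second difference of step 1/q of the periodic parabola: on [1/q, 1 - 1/q] it is constant and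
    cancels the added 1/q. In Fourier terms it multiplies 1/n^2 by 1 - cos(2 pi n/q) >= 0. *)
Lemma hat_function_exists q : (2 <= q)%N -> exists D d, hat_function (R := R) q D d.
Proof.
move=> q2; have q0 : 0 < q%:R :> R by rewrite ltr0n; lia.
have qn0 : q%:R != 0 :> R by rewrite gt_eqF.
pose i : R := q%:R^-1.
have i0 : 0 < i by rewrite invr_gt0.
have i2 : i <= 2^-1 by rewrite lef_pV2 ?posrE // ler_nat.
have pi0 := pi_gt0 R; have pin0 : pi != 0 :> R by rewrite gt_eqF.
pose S := cosq_sum.
pose D x := i + q%:R / pi ^+ 2 * (S x - (S (x - i) + S (x + i)) / 2).
(* The constant 1/q enters at n = 0 only, where the other summand of [d] is 0. *)
pose e n : R := if n == 0%N then i else 0.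
pose d n : R := e n + q%:R / pi ^+ 2 * ((n%:R ^+ 2)^-1 * (1 - lcos R q n)).
have Sc := cosq_sum_continuous.
exists D, d; split.
- move=> x; apply: cvgD; first exact: cvg_cst.
  apply: cvgMr; apply: cvgB; first exact: Sc.
  apply: cvgMl; apply: cvgD; (apply: continuous_comp; last exact: Sc).
    by apply: cvgB => //; exact: cvg_cst.
  by apply: cvgD => //; exact: cvg_cst.
- by move=> x; rewrite /D -[x + 1 - i]addrAC -[x + 1 + i]addrAC /S !cosq_sumD1.
- split.
    rewrite /D sub0r add0r /S cosq_sumN (@cosq_sumE 0) ?lexx ?ler01 //.
    rewrite (@cosq_sumE i); last by apply/andP; split; lra.
    by rewrite /i; move: (pi : R) pin0 => w w0; field; rewrite qn0 w0.
  move=> x xi; have /andP[xi1 xi2] : i <= x <= 1 - i by [].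
  rewrite /D /S (@cosq_sumE x); last by apply/andP; split; lra.
  rewrite (@cosq_sumE (x - i)); last by apply/andP; split; lra.
  rewrite (@cosq_sumE (x + i)); last by apply/andP; split; lra.
  by rewrite /i; move: (pi : R) pin0 => w w0; field; rewrite qn0 w0.
- move=> x.
  have -> : series (fun n => d n * cos (2 * pi * n%:R * x)) =
      fun N => series e N + q%:R / pi ^+ 2 * (series (cosq ^~ x) N -
       (series (cosq ^~ (x - i)) N + series (cosq ^~ (x + i)) N) / 2).
    apply/funext => N; elim: N => [|N IH].
      by rewrite /series /= !big_geq //; ring.
    rewrite !seriesSr IH /d /e /cosq (mulrBr (2 * pi * N%:R)) cosB (mulrDr (2 * pi * N%:R)) cosD.
    rewrite (_ : lcos R q N = cos (2 * pi * N%:R * i)); last by rewrite /lcos mulrA.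
    have e0 : (if N == 0%N then i else 0) * cos (2 * pi * N%:R * x) =
        if N == 0%N then i else 0.
      by case: eqP => [->|_]; rewrite ?mul0r // mulr0 mul0r cos0 mulr1.
    rewrite (mulrDl (if N == 0%N then i else 0)) e0.
    move: (if _ then _ else _) (q%:R / pi ^+ 2) ((N%:R ^+ 2)^-1) => A B F; by field.
  apply: cvgD.
    rewrite -(cvg_shiftS (series e)) (_ : [sequence _]_n = cst i).
      exact: cvg_cst.
    apply/funext => n; rewrite /series /= big_nat_recl // big1 ?addr0 //.
  apply: cvgMr; apply: cvgB; first exact: cosq_sum_cvg.
  by apply: cvgMl; apply: cvgD; exact: cosq_sum_cvg.
- split; first by rewrite /d /e eqxx lcos0 subrr !mulr0 addr0.
  move=> n; rewrite addr_ge0 //; first by rewrite /e; case: ifP => // _; exact: ltW.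
  rewrite mulr_ge0 ?divr_ge0 ?exprn_ge0 ?(ltW pi0) ?(ltW q0) //.
  by rewrite mulr_ge0 ?invr_ge0 ?exprn_ge0 // subr_ge0 cos_le1.
Qed.

End SumCosDivSquares.

(** * Chebyshev polynomials and double roots *)

Section Chebyshev.
Variable R : realType.
Implicit Types (p g : {poly R}) (a t : R) (n q : nat).

(* Chebyshev polynomials of both kinds: T_n and U_(n-1). *)
Fixpoint cheb n : {poly R} * {poly R} :=
  if n is n'.+1 then
    let: (f, g) := cheb n' in ('X * f - (1 - 'X ^+ 2) * g, 'X * g + f)
  else (1, 0).

Lemma chebS n : cheb n.+1 =
  ('X * (cheb n).1 - (1 - 'X ^+ 2) * (cheb n).2, 'X * (cheb n).2 + (cheb n).1).
Proof. by rewrite /=; case: (cheb n). Qed.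

Lemma cheb_cos n t :
  (cheb n).1.[cos t] = cos (n%:R * t) /\
  (cheb n).2.[cos t] * sin t = sin (n%:R * t).
Proof.
elim: n => [|n [IH1 IH2]].
  by rewrite /= !hornerE cos0 sin0.
have -> : n.+1%:R * t = n%:R * t + t by rewrite -natr1; ring.
rewrite chebS cosD sinD -IH1 -IH2; split; rewrite /= !hornerE.
  have := cos2Dsin2 t; move: (cos t) (sin t) => c s e.
  have -> : 1 - c ^+ 2 = s ^+ 2 by rewrite -e; ring.
  ring.
ring.
Qed.

Lemma size_cheb n :
  (size (cheb n).1 <= n.+1)%N /\ (size (cheb n).2 <= n)%N.
Proof.
elim: n => [|n [IH1 IH2]]; first by rewrite /= size_poly1 size_poly0.
have sX (p : {poly R}) m : (size p <= m)%N -> (size ('X * p)%R <= m.+1)%N.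
  by move=> pm; rewrite mulrC (leq_trans (size_polyMleq _ _)) // size_polyX addn2.
rewrite chebS; split => /=; apply: (leq_trans (size_polyD _ _)); rewrite geq_max.
  rewrite sX //= size_polyN mulrBl mul1r.
  rewrite (leq_trans (size_polyD _ _)) // geq_max (leq_trans IH2) //=; last by lia.
  by rewrite size_polyN expr2 -mulrA !sX.
by rewrite sX.
Qed.

(** Both identities are proved in one induction. The first locates the double roots of 1 - T_q; at
    such a root U_(q-1) = 0, so the second yields the second derivative there. *)
Lemma cheb_deriv n :
  (cheb n).1^`() = n%:R *: (cheb n).2 /\
  (1 - 'X ^+ 2) * (cheb n).2^`() = 'X * (cheb n).2 - n%:R *: (cheb n).1.
Proof.
elim: n => [|n [IH1 IH2]].
  by rewrite /= -polyC1 derivC linear0 (linear0 (@deriv R)) !mulr0 !scale0r subrr.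
rewrite chebS /=; move: (cheb n).1 (cheb n).2 IH1 IH2 => f g IH1 IH2; split.
  rewrite derivB !derivM derivX derivB derivC derivXn /= IH1.
  have -> : (0 - 'X^1 *+ 2) * g + (1 - 'X ^+ 2) * g^`() =
     - 'X *+ 2 * g + ('X * g - n%:R *: f) by rewrite IH2 expr1; ring.
  rewrite -!mul_polyC -natr1 polyCD; ring.
rewrite derivD derivM derivX IH1.
have -> : (1 - 'X ^+ 2) * (1 * g + 'X * g^`() + n%:R *: g) =
   (1 - 'X ^+ 2) * g + 'X * ((1 - 'X ^+ 2) * g^`()) + (1 - 'X ^+ 2) * (n%:R *: g).
  by rewrite -!mul_polyC; ring.
by rewrite IH2 -!mul_polyC -natr1 polyCD; ring.
Qed.

Lemma root_factor p a : p.[a] = 0 -> exists g, p = ('X - a%:P) * g.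
Proof. by move/eqP/factor_theorem => [g ->]; exists g; rewrite mulrC. Qed.

Lemma deriv2_double p g a : p = ('X - a%:P) ^+ 2 * g ->
  p^`()^`().[a] = 2 * g.[a].
Proof.
move=> ->; set x := 'X - a%:P.
have -> : (x ^+ 2 * g)^`() = x * (g *+ 2 + x * g^`()).
  by rewrite expr2 !derivM derivXsubC; ring.
by rewrite derivM derivXsubC !hornerE subrr !mul0r !addr0 mulr_natl.
Qed.

Lemma double_root_factor p a : p.[a] = 0 -> p^`().[a] = 0 ->
  exists g, p = ('X - a%:P) ^+ 2 * g.
Proof.
move=> /root_factor[g ->]; rewrite derivM derivXsubC !hornerE subrr mul0r addr0.
by move=> /root_factor[h ->]; exists h; rewrite mulrA.
Qed.

(** When a new root a is split off, the product over the other roots is nonzero at a, so the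
    cofactor inherits both vanishing conditions. *)
Lemma double_roots_factor p (s : seq R) : uniq s ->
  (forall a, a \in s -> p.[a] = 0 /\ p^`().[a] = 0) ->
  exists g, p = (\prod_(a <- s) ('X - a%:P)) ^+ 2 * g.
Proof.
elim: s => [|a s IH] /=; first by exists p; rewrite big_nil expr1n mul1r.
move=> /andP[anin us] ps; have [|g pE] := IH us.
  by move=> b bs; apply: ps; rewrite inE bs orbT.
have Da : (\prod_(b <- s) ('X - b%:P)).[a] != 0.
  rewrite horner_prod prodf_seq_neq0; apply/allP => b bs /=.
  by rewrite !hornerE subr_eq0; apply: contraNneq anin => ->.
have [] := ps a (mem_head _ _); rewrite pE derivM !hornerE.
set D := \prod_(b <- s) _ in Da pE *.
move=> /eqP; rewrite mulf_eq0 expf_eq0 (negPf Da) andbF /= => /eqP ga.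
rewrite ga mulr0 add0r => /eqP; rewrite mulf_eq0 expf_eq0 (negPf Da) andbF /= => /eqP.
move=> /(double_root_factor ga)[h gE]; exists h.
by rewrite big_cons gE -/D; ring.
Qed.

End Chebyshev.

(** * Polynomials in cos t as cosine polynomials *)

Section CosineSpan.
Variable R : realType.
Implicit Types (f g : R -> R) (n k : nat).

Definition cos_span n f :=
  exists c : nat -> R, forall t, f t = \sum_(0 <= k < n) c k * cos (k%:R * t).

Lemma cos_spanD n f g : cos_span n f -> cos_span n g -> cos_span n (fun t => f t + g t).
Proof.
move=> [c fE] [d gE]; exists (fun k => c k + d k) => t.
by rewrite fE gE -big_split; apply: eq_bigr => k _; rewrite mulrDl.
Qed.

Lemma cos_spanZ n a f : cos_span n f -> cos_span n (fun t => a * f t).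
Proof.
move=> [c fE]; exists (fun k => a * c k) => t.
by rewrite fE mulr_sumr; apply: eq_bigr => k _; rewrite mulrA.
Qed.

Lemma cos_span_cos n k : (k < n)%N -> cos_span n (fun t => cos (k%:R * t)).
Proof.
move=> kn; exists (fun j => (j == k)%:R) => t.
rewrite (bigD1_seq k) ?iota_uniq ?mem_index_iota //= eqxx mul1r big1 ?addr0 //.
by move=> j /negPf ->; rewrite mul0r.
Qed.

Lemma cos_span_ext n f g : f =1 g -> cos_span n f -> cos_span n g.
Proof. by move=> fg [c fE]; exists c => t; rewrite -fg. Qed.

Lemma cos_span_sum n m (F : nat -> R -> R) :
  (forall k, (k < m)%N -> cos_span n (F k)) ->
  cos_span n (fun t => \sum_(0 <= k < m) F k t).
Proof.
elim: m => [|m IH] Fk.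
  by exists (fun=> 0) => t; rewrite big_geq // big1 // => k _; rewrite mul0r.
apply: (@cos_span_ext _ (fun t => \sum_(0 <= k < m) F k t + F m t)).
  by move=> t; rewrite big_nat_recr.
by apply: cos_spanD; [apply: IH => k km; apply: Fk; lia | exact: Fk].
Qed.

Lemma cos_span_mulcos n f : cos_span n f -> cos_span n.+1 (fun t => cos t * f t).
Proof.
move=> [c fE].
(* The natural number [k.-1 + (1 - k)] is |k - 1|, which covers k = 0 as well. *)
apply: (@cos_span_ext _ (fun t => \sum_(0 <= k < n)
   c k / 2 * (cos (k.+1%:R * t) + cos (((k.-1 + (1 - k))%N)%:R * t)))).
  move=> t; rewrite fE mulr_sumr; apply: eq_bigr => k _.
  rewrite mulrCA [cos t * _]mulrC cosM -[X in cos (_ + X)]mul1r -mulrDl natr1.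
  have -> : cos (((k.-1 + (1 - k))%N)%:R * t) = cos (k%:R * t - t).
    case: k => [|k]; first by rewrite /= mul1r mul0r sub0r cosN.
    by rewrite subSS sub0n addn0 /=; congr cos; rewrite -natr1; ring.
  by field.
apply: cos_span_sum => k kn; apply: cos_spanZ.
by apply: cos_spanD; apply: cos_span_cos; lia.
Qed.

Lemma cos_span_poly n (W : {poly R}) : (size W <= n)%N ->
  cos_span n (fun t => W.[cos t]).
Proof.
elim: n W => [|n IH] W.
  rewrite leqn0 size_poly_eq0 => /eqP ->.
  by exists (fun=> 0) => t; rewrite big_geq // horner0.
elim/poly_ind: W => [_|W a _ sW].
  by exists (fun=> 0) => t; rewrite horner0 big1 // => k _; rewrite mul0r.
have sW' : (size W <= n)%N.
  have [->|W0] := eqVneq W 0; first by rewrite size_poly0.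
  by move: sW; rewrite size_MXaddC (negPf W0).
apply: (@cos_span_ext _ (fun t => cos t * W.[cos t] + a * cos (0%:R * t))).
  by move=> t; rewrite !hornerE cos0 mulr1 mulrC.
apply: cos_spanD; first by apply: cos_span_mulcos; exact: IH.
by apply: cos_spanZ; exact: cos_span_cos.
Qed.

End CosineSpan.

(** * Reading Fourier coefficients from lattice values *)

Section Quadrature.
Variable R : realType.
Implicit Types (W : {poly R}) (q m k j p : nat) (mu : nat -> R).

Lemma lcos_poly W n (c : nat -> R) q m :
  (forall t, W.[cos t] = \sum_(0 <= k < n) c k * cos (k%:R * t)) ->
  W.[lcos R q m] = \sum_(0 <= k < n) c k * lcos R q (m * k).
Proof.
move=> WE; rewrite WE; apply: eq_bigr => k _; congr (_ * cos _).
by rewrite natrM; ring.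
Qed.

(** The condition n + j <= q excludes aliasing: for k < n, both k + j and, when k differs from j, |k
    - j| lie strictly between 0 and q. *)
Lemma lattice_coef n (c : nat -> R) q j : (0 < j)%N -> (j < n)%N -> (n + j <= q)%N ->
  \sum_(0 <= m < q) (\sum_(0 <= k < n) c k * lcos R q (m * k)) * lcos R q (m * j)
  = q%:R / 2 * c j.
Proof.
move=> j0 jn njq; have q0 : (0 < q)%N by lia.
under eq_bigr => m _ do rewrite mulr_suml.
rewrite exchange_big /= (bigD1_seq j) ?iota_uniq ?mem_index_iota //= [X in _ + X]big1_seq.
  under eq_bigr => m _ do rewrite -mulrA.
  rewrite addr0 -mulr_sumr sum_lcosM // subnn dvdn0 gtnNdvd ?add0r 1?mulrC //; lia.
move=> k /andP[kj]; rewrite mem_index_iota => kn.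
under eq_bigr => m _ do rewrite -mulrA.
by rewrite -mulr_sumr sum_lcosM // !gtnNdvd ?addr0 ?mul0r ?mulr0 //; lia.
Qed.

(** T(x) = W(cos 2 pi x) has frequencies at most q - p, which is just low enough for its
    coefficients at 1, ..., p - 1 to be read from the lattice; the moment conditions make them 0.
    Complementary slackness then gives T_0 = mu_0. *)
Lemma poly_extremal p q W mu : (0 < p)%N -> (2 * p <= q)%N -> (2 <= q)%N ->
  (size W <= (q - p).+1)%N ->
  (forall y, -1 <= y <= 1 -> 0 <= W.[y]) -> W.[1] = 1 ->
  (forall j, (0 < j < p)%N -> \sum_(0 <= m < q) W.[lcos R q m] * lcos R q (m * j) = 0) ->
  dual_weight p q mu ->
  (forall m, (0 < m < q)%N -> mu m * W.[lcos R q m] = 0) ->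
  exists H c, admissible_poly (K0 p q) H c /\ c 0%N = mu 0%N.
Proof.
move=> p0 pq q2 sW W0 W1 Wj [mu0 mu1 muK] slack.
have [c cE] := cos_span_poly sW.
have cj j : (0 < j < p)%N -> c j = 0.
  move=> jp; move: (Wj j jp).
  under eq_bigr => m _ do rewrite (lcos_poly _ _ cE).
  rewrite lattice_coef; try lia.
  have q2n : q%:R / 2 != 0 :> R by rewrite mulf_neq0 // pnatr_eq0; lia.
  by move/eqP; rewrite mulf_eq0 (negPf q2n) /= => /eqP.
(* The mu-average of W is computed twice: slackness leaves only m = 0, while expansion in
   frequencies leaves only the constant coefficient. *)
have c0 : c 0%N = mu 0%N.
  have : \sum_(0 <= m < q) mu m * W.[lcos R q m] = mu 0%N.
    rewrite big_ltn; last lia.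
    rewrite lcos0 W1 mulr1 big1_seq ?addr0 // => m.
    by rewrite mem_index_iota => /andP[_]; exact: slack.
  move <-; under eq_bigr => m _ do rewrite (lcos_poly _ _ cE) mulr_sumr.
  rewrite exchange_big /= big_ltn // [X in _ + X]big1_seq => [|k /andP[_]].
    under eq_bigr => m _ do rewrite muln0 lcos0 mulr1.
    by rewrite -mulr_suml mu1 mul1r addr0.
  rewrite mem_index_iota => kn.
  under eq_bigr => m _ do rewrite mulrCA.
  rewrite -mulr_sumr; have [kp|kp] := ltnP k p; first by rewrite cj ?mul0r //; lia.
  by rewrite muK ?mulr0 //; lia.
exists q, c; split=> //.
have E x : cos_poly (K0 p q) q c x = W.[cos (2 * pi * x)].
  rewrite cE /cos_poly [RHS]big_ltn // mul0r cos0 mulr1; congr (_ + _).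
  rewrite (@big_cat_nat _ _ _ (q - p).+1 1 q.+1) //=; try lia.
  rewrite [X in _ + X]big1_seq ?addr0 => [|k].
    rewrite big_mkcond; apply: eq_big_nat => k kn; rewrite K0P.
    case: ifP => kp; first by congr (_ * cos _); ring.
    by rewrite cj ?mul0r //; lia.
  rewrite K0P mem_index_iota; lia.
split=> // [x|]; first by rewrite E W0 // cos_geN1 cos_le1.
by rewrite E mulr0 cos0.
Qed.

End Quadrature.

(** * The quotient of 1 - T_q by squared node factors *)

Section FejerQuotient.
Variable R : realType.
Variables (q : nat) (S : seq nat).
Hypothesis Suniq : uniq S.
Hypothesis Sq : forall s, s \in S -> (0 < s)%N /\ (2 * s < q)%N.
Hypothesis q0 : (0 < q)%N.

Local Notation a := (lcos R q).

Lemma lcos_inj m n : (2 * m <= q)%N -> (2 * n <= q)%N -> a m = a n -> m = n.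
Proof.
move=> mq nq e; apply/eqP; rewrite eqn_leq; apply/andP; split; rewrite leqNgt.
  by apply/negP => /(ltr_lcos R mq); rewrite e ltxx.
by apply/negP => /(ltr_lcos R nq); rewrite e ltxx.
Qed.

Lemma lcos_eq1 s : s \in S -> a s != 1.
Proof.
move=> /Sq[s0 sq]; rewrite -(lcos0 R q); apply: contra_neq (lt0n_neq0 s0).
by apply: lcos_inj; lia.
Qed.

Lemma sin_lattice_gt0 s : s \in S -> 0 < sin (2 * pi * (s%:R / q%:R)) :> R.
Proof.
move=> /Sq[s0 sq]; have pi0 := pi_gt0 R; apply: sin_gt0_pi.
apply/andP; split.
  by apply: mulr_gt0; [exact: mulr_gt0 | rewrite divr_gt0 // ltr0n].
rewrite mulrAC -[ltRHS]mul1r ltr_pM2r // mulrA ltr_pdivrMr ?ltr0n //.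
by rewrite mul1r -natrM ltr_nat.
Qed.

Let U : {poly R} := 1 - (cheb R q).1.

Lemma cheb_lattice m : (cheb R q).1.[a m] = 1.
Proof.
rewrite (cheb_cos _ _).1.
have -> : q%:R * (2 * pi * (m%:R / q%:R)) = 0 + 2 * pi * m%:R :> R.
  have : q%:R != 0 :> R by rewrite pnatr_eq0 -lt0n.
  by move=> ?; field.
by rewrite cosDnat2pi cos0.
Qed.

Lemma cheb2_one n : (cheb R n).2.[1] = n%:R.
Proof.
elim: n => [|n IH]; first by rewrite /= horner0.
rewrite chebS /= !hornerE IH -natr1; congr (_ + _).
by have [+ _] := cheb_cos n (0 : R); rewrite mulr0 cos0.
Qed.

Lemma cheb2_lattice s : s \in S -> (cheb R q).2.[a s] = 0.
Proof.
move=> sS; apply: (mulIf (lt0r_neq0 (sin_lattice_gt0 sS))).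
rewrite (cheb_cos _ _).2 mul0r.
have -> : q%:R * (2 * pi * (s%:R / q%:R)) = 0 + (pi *+ 2) *+ s :> R.
  rewrite -[(pi *+ 2) *+ s]mulr_natr -[pi *+ 2]mulr_natr.
  have : q%:R != 0 :> R by rewrite pnatr_eq0 -lt0n.
  by move=> ?; field.
by rewrite (periodicn (@sinD2pi R)) sin0.
Qed.

(** 1 - T_q vanishes at 1 and doubly at each node cos(2 pi s/q), since 0 < s < q/2. The value of P
    at 1 comes from T_q'(1) = q^2, its values at the nodes from the second derivative there. For
    empty S this is a multiple of the Fejer kernel. *)
Lemma fejer_quotient : exists P : {poly R},
  [/\ 1 - (cheb R q).1 = (1 - 'X) * (\prod_(s <- S) ('X - (a s)%:P)) ^+ 2 * P,
      (size P + 2 * size S <= q)%N,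
      P.[1] * \prod_(s <- S) (1 - a s) ^+ 2 = q%:R ^+ 2 &
      forall s, s \in S -> P.[a s] * (2 * (1 - a s ^+ 2) * (1 - a s) *
        \prod_(r <- S | r != s) (a s - a r) ^+ 2) = q%:R ^+ 2].
Proof.
have U' : U^`() = - (q%:R *: (cheb R q).2).
  by rewrite derivB -polyC1 derivC (cheb_deriv _ _).1 sub0r.
have Um m : U.[a m] = 0 by rewrite /U !hornerE cheb_lattice subrr.
have aS : uniq (map a S).
  rewrite map_inj_in_uniq // => s r /Sq[_ sq] /Sq[_ rq].
  by apply: lcos_inj; exact: ltnW.
have [|g UE] := @double_roots_factor R U _ aS.
  move=> _ /mapP[s sS ->]; split; first exact: Um.
  by rewrite U' !hornerE cheb2_lattice // mulr0 oppr0.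
rewrite big_map in UE; set D := \prod_(s <- S) _ in UE.
have D1 : D.[1] = \prod_(s <- S) (1 - a s).
  by rewrite horner_prod; apply: eq_bigr => s _; rewrite !hornerE.
have D1n : D.[1] != 0.
  rewrite D1 prodf_seq_neq0; apply/allP => s /lcos_eq1 s1 /=.
  by rewrite subr_eq0 eq_sym.
have g1 : g.[1] = 0.
  have := Um 0%N; rewrite lcos0 UE !hornerE => /eqP.
  by rewrite mulf_eq0 expf_eq0 (negPf D1n) andbF /= => /eqP.
have [h gE] := root_factor g1; exists (- h).
have UE' : U = (1 - 'X) * D ^+ 2 * - h by rewrite UE gE; ring.
have P1 : (- h).[1] * \prod_(s <- S) (1 - a s) ^+ 2 = q%:R ^+ 2.
  have d1 (G : {poly R}) : ((1 - 'X) * G)^`().[1] = - G.[1].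
    rewrite derivM derivB derivX -polyC1 derivC sub0r hornerD !hornerM.
    by rewrite hornerD !hornerN !hornerC hornerX subrr mul0r addr0 mulN1r.
  rewrite prodrXl -D1; have := d1 (D ^+ 2 * - h).
  rewrite mulrA -UE' U' hornerN hornerZ cheb2_one hornerM horner_exp => /oppr_inj.
  by rewrite -expr2 mulrC => ->.
split=> //.
- have h0 : - h != 0.
    apply: contra_eq_neq P1 => ->; rewrite horner0 mul0r eq_sym expf_eq0 /=.
    by rewrite pnatr_eq0 -lt0n.
  have X1 : size (1 - 'X : {poly R}) = 2%N.
    by rewrite -opprB size_polyN -polyC1 size_XsubC.
  have DS : size D = (size S).+1 by rewrite size_prod_XsubC.
  have : (size U <= q.+1)%N.
    rewrite (leq_trans (size_polyD _ _)) // size_polyN geq_max size_poly1 /=.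
    exact: (size_cheb _ _).1.
  have D0 : D != 0 by rewrite -size_poly_eq0 DS.
  have D20 : D ^+ 2 != 0 by rewrite expf_neq0.
  have X0 : (1 - 'X : {poly R}) != 0 by rewrite -size_poly_eq0 X1.
  rewrite UE' size_mul ?mulf_neq0 // size_mul // X1 expr2 size_mul // DS !size_polyN.
  by move: (size h) (size S) => x y; lia.
- move=> s sS.
  have DE : D = ('X - (a s)%:P) * \prod_(r <- S | r != s) ('X - (a r)%:P).
    by rewrite /D (bigD1_seq s).
  have [E Ea UEs] : exists2 E : {poly R},
      E.[a s] = \prod_(r <- S | r != s) (a s - a r) ^+ 2 &
      U = ('X - (a s)%:P) ^+ 2 * ((1 - 'X) * E * - h).
    exists ((\prod_(r <- S | r != s) ('X - (a r)%:P)) ^+ 2).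
      rewrite horner_exp horner_prod prodrXl; congr (_ ^+ 2).
      by apply: eq_bigr => r _; rewrite hornerXsubC.
    by rewrite UE' DE; ring.
  have hX b : (1 - 'X : {poly R}).[b] = 1 - b.
    by rewrite hornerD hornerN -polyC1 hornerC hornerX.
  have e1 := congr1 (horner^~ (a s)) (cheb_deriv R q).2.
  have hX2 b : (1 - 'X ^+ 2 : {poly R}).[b] = 1 - b ^+ 2.
    by rewrite hornerD hornerN horner_exp -polyC1 hornerC hornerX.
  have := deriv2_double UEs; move: e1.
  rewrite U' derivN derivZ hornerN !hornerZ !hornerM hX hX2 Ea hornerD hornerN hornerM hornerZ.
  rewrite cheb2_lattice // cheb_lattice mulr0 sub0r mulr1 hornerN.
  move: (_^`().[a s]) (\prod_(r <- S | _) _) (h.[a s]) => v d w e1 e2.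
  have -> : - w * (2 * (1 - a s ^+ 2) * (1 - a s) * d) =
     (1 - a s ^+ 2) * (2 * ((1 - a s) * d * - w)) by ring.
  by rewrite -e2 mulrN mulrCA e1; ring.
Qed.

End FejerQuotient.

(** * Extremal polynomials from the quotient and a factor of low degree *)

Section FejerExtremal.
Variable R : realType.
Variables (q : nat) (S : seq nat).
Hypothesis Suniq : uniq S.
Hypothesis Sq : forall s, s \in S -> (0 < s)%N /\ (2 * s < q)%N.
Hypothesis q0 : (0 < q)%N.

Local Notation a := (lcos R q).

(** A node s and its mirror q - s contribute equally and are distinct because 2s < q, hence the
    factor 2. *)
Lemma sum_lattice (F : nat -> R) :
  (forall m, (0 < m < q)%N -> m \notin S -> (q - m)%N \notin S -> F m = 0) ->
  (forall m, (m <= q)%N -> F (q - m)%N = F m) ->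
  \sum_(0 <= m < q) F m = F 0%N + 2 * \sum_(s <- S) F s.
Proof.
move=> F0 Fsym; rewrite big_ltn //; congr (_ + _).
pose S' := [seq (q - s)%N | s <- S].
have -> : 2 * \sum_(s <- S) F s = \sum_(s <- S ++ S') F s.
  rewrite big_cat /= big_map mulr_natl mulr2n; congr (_ + _).
  by apply: eq_big_seq => s /Sq[_ sq]; rewrite Fsym //; lia.
rewrite (bigID (mem (S ++ S'))) /= [X in _ + X]big1_seq ?addr0.
  rewrite -big_filter; apply: perm_big; apply: uniq_perm.
  - by rewrite filter_uniq // iota_uniq.
  - rewrite cat_uniq Suniq /= map_inj_in_uniq => [|s r /Sq[_ sq] /Sq[_ rq]]; last by lia.
    rewrite Suniq andbT; apply/hasPn => _ /mapP[s /Sq[_ sq] ->].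
    by apply/negP => /= /Sq; lia.
  - move=> m; rewrite mem_filter mem_index_iota; apply: andb_idr.
    by rewrite mem_cat => /orP[/Sq|/mapP[s /Sq ? ->]]; lia.
move=> m /andP[]; rewrite mem_cat mem_index_iota negb_or => /andP[mS mS'] mq.
apply: F0 => //; apply: contra mS' => mS'; apply/mapP; exists (q - m)%N => //; lia.
Qed.

Lemma lcos_neq_node m s : (0 < m < q)%N -> m \notin S -> (q - m)%N \notin S ->
  s \in S -> a m != a s.
Proof.
move=> mq mS mS' sS; have [s0 sq] := Sq sS.
have [m2|m2] := leqP (2 * m) q.
  by apply: contraNneq mS => /(lcos_inj (R := R)) -> //; lia.
rewrite -lcosB //; last by lia.
by apply: contraNneq mS' => /(lcos_inj (R := R)) -> //; lia.
Qed.

Lemma lcos_neq1 m : (0 < m < q)%N -> a m != 1.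
Proof.
move=> mq; rewrite -(lcos0 R q); have [m2|m2] := leqP (2 * m) q.
  by apply/eqP => /(lcos_inj (R := R)); lia.
rewrite -lcosB //; last by lia.
by apply/eqP => /(lcos_inj (R := R)); lia.
Qed.

Lemma lcos_lt1 s : s \in S -> -1 < a s < 1.
Proof.
move=> sS; have s0 := sin_lattice_gt0 R Sq q0 sS.
have := cos2Dsin2 (2 * pi * (s%:R / q%:R) : R); rewrite -/(a s).
have : 0 < sin (2 * pi * (s%:R / q%:R)) ^+ 2 :> R by rewrite exprn_gt0.
by move=> s2 e; apply/andP; split; nra.
Qed.

Lemma prod_node_gt0 (b : R) (P : pred nat) : (forall s, s \in S -> P s -> b != a s) ->
  0 < \prod_(s <- S | P s) (b - a s) ^+ 2.
Proof.
move=> bs; rewrite big_seq_cond; apply: prodr_gt0 => s /andP[sS Ps].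
by rewrite lt_neqAle sqr_ge0 andbT eq_sym expf_eq0 /= subr_eq0 bs.
Qed.

(** W = P L/q^2 takes on the lattice the value 1 at 0, A s at s and q - s, and 0 elsewhere; this is
    what dictates the values of L. The equations on A are the moment conditions for p = |S| + 1, and
    since mu vanishes where W may not, slackness holds. *)
Lemma fejer_extremal (L : {poly R}) (A mu : nat -> R) :
  (2 * (size S).+1 <= q)%N ->
  (size L <= (size S).+1)%N ->
  (forall y, -1 <= y <= 1 -> 0 <= L.[y]) ->
  L.[1] = \prod_(s <- S) (1 - a s) ^+ 2 ->
  (forall s, s \in S -> L.[a s] = A s * (2 * (1 - a s ^+ 2) * (1 - a s) *
        \prod_(r <- S | r != s) (a s - a r) ^+ 2)) ->
  (forall j, (0 < j <= size S)%N -> 1 + 2 * \sum_(s <- S) A s * lcos R q (s * j) = 0) ->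
  dual_weight (size S).+1 q mu ->
  (forall s, s \in S -> mu s = 0 /\ mu (q - s)%N = 0) ->
  exists H c, admissible_poly (K0 (size S).+1 q) H c /\ c 0%N = mu 0%N.
Proof.
move=> Sle sL L0 L1 LA Aj dw muS.
have [P [UP sP P1 PA]] := fejer_quotient R Suniq Sq q0.
have qR : 0 < q%:R ^+ 2 :> R by rewrite exprn_gt0 // ltr0n.
have qn : q%:R ^+ 2 != 0 :> R by rewrite gt_eqF.
pose W := (q%:R ^+ 2)^-1 *: (P * L).
have WE y : W.[y] = (q%:R ^+ 2)^-1 * (P.[y] * L.[y]) by rewrite hornerZ hornerM.
have UE y : 1 - (cheb R q).1.[y] =
    (1 - y) * \prod_(s <- S) (y - a s) ^+ 2 * P.[y].
  have := congr1 (horner^~ y) UP.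
  rewrite hornerD hornerN -polyC1 hornerC => ->.
  rewrite !hornerM hornerD hornerN hornerC hornerX -hornerM -expr2 horner_exp.
  rewrite horner_prod prodrXl; congr (_ * _ ^+ 2 * _).
  by apply: eq_bigr => s _; rewrite hornerXsubC.
have d1 : 0 < \prod_(s <- S) (1 - a s) ^+ 2.
  by apply: prod_node_gt0 => s sS _; rewrite gt_eqF //; case/andP: (lcos_lt1 sS).
have dA s : s \in S -> 0 < 2 * (1 - a s ^+ 2) * (1 - a s) *
        \prod_(r <- S | r != s) (a s - a r) ^+ 2.
  move=> sS; have /andP[l1 l2] := lcos_lt1 sS; have [s0 sq] := Sq sS.
  apply: mulr_gt0; first by apply: mulr_gt0; nra.
  apply: prod_node_gt0 => r rS rs; have [r0 rq] := Sq rS.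
  by apply: contraNneq rs => /(lcos_inj (R := R)) -> //; lia.
(* Off 1 and the nodes, the sign of P is that of 1 - T_q >= 0; at those points the explicit values
   of P decide. *)
have P0 y : -1 <= y <= 1 -> 0 <= P.[y].
  move=> y1; have U0 : 0 <= 1 - (cheb R q).1.[y].
    by rewrite subr_ge0 -(acosK (x := y)) ?in_itv // (cheb_cos _ _).1 cos_le1.
  have [->|yn1] := eqVneq y 1.
    by rewrite -(pmulr_lge0 _ d1) P1 ltW.
  have [/mapP[s sS ->]|yS] := boolP (y \in map a S).
    by rewrite -(pmulr_lge0 _ (dA s sS)) PA // ltW.
  rewrite UE pmulr_rge0 // in U0; apply: mulr_gt0.
    by rewrite subr_gt0 lt_neqAle yn1; case/andP: y1.
  by apply: prod_node_gt0 => s sS _; apply: contraNneq yS => ->; exact: map_f.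
have Wm m : (0 < m < q)%N -> m \notin S -> (q - m)%N \notin S -> W.[a m] = 0.
  move=> mq mS mS'; have := UE (a m); rewrite cheb_lattice // subrr => /esym/eqP.
  rewrite mulf_eq0 gt_eqF /=.
    by move=> /eqP Pm; rewrite WE Pm mul0r mulr0.
  apply: mulr_gt0; first by rewrite subr_gt0 lt_neqAle lcos_neq1 // cos_le1.
  by apply: prod_node_gt0 => s sS _; exact: lcos_neq_node.
have WA s : s \in S -> W.[a s] = A s.
  by move=> sS; rewrite WE LA // [P.[_] * _]mulrCA PA // mulrCA mulVf ?mulr1.
have W1 : W.[1] = 1 by rewrite WE L1 P1 mulVf.
apply: (poly_extremal (W := W)) => //.
- lia.
- rewrite (leq_trans (size_scale_leq _ _)) // (leq_trans (size_polyMleq _ _)) //; lia.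
- by move=> y y1; rewrite WE mulr_ge0 ?invr_ge0 ?(ltW qR) // mulr_ge0 ?P0 ?L0.
- move=> j jS; rewrite sum_lattice; last first.
  + by move=> m mq; rewrite lcosB // lcosBM.
  + by move=> m mq mS mS'; rewrite Wm // mul0r.
  rewrite mul0n lcos0 W1 mulr1 -[RHS](Aj j); last lia.
  by congr (_ + 2 * _); apply: eq_big_seq => s sS; rewrite WA.
- move=> m mq; have [mS|mS] := boolP (m \in S); first by rewrite (muS m mS).1 mul0r.
  have [mS'|mS'] := boolP ((q - m)%N \in S); last by rewrite Wm ?mulr0.
  have [_] := muS _ mS'; rewrite subKn ?mul0r; last lia.
  by move->; rewrite mul0r.
Qed.

End FejerExtremal.

(** * Nonnegativity of the quadratic factor for p = 3 *)

Section QuadraticFactor.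
Variable R : realType.
Implicit Types (al be c : R).

(* Up to a constant factor, the quadratic polynomial with the values prescribed
   for [L] in [fejer_extremal] at 1, al, be, in Lagrange form. *)
Definition quad3 al be c : R :=
  (1 + 2 * al * be) * (c - al) * (c - be) +
  (2 * be + 1) * (1 + al) * (c - be) * (c - 1) +
  (2 * al + 1) * (1 + be) * (c - al) * (c - 1).

(** The numbers al and be lie on either side of cos(2 pi/3) = -1/2; a and b measure their distances
    to it, and u = c + 1 >= 0 makes the quadratic A2 u^2 + B u + N1 with A2, N1 >= 0. *)
Lemma quad3_ge0 al be c : - 2^-1 <= al <= 0 -> -1 <= be <= - 2^-1 ->
  -1 <= c <= 1 -> 0 <= quad3 al be c.
Proof.
move=> /andP[al1 al2] /andP[be1 be2] /andP[c1 c2].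
pose a := al + 2^-1; pose b := - 2^-1 - be.
have a0 : 0 <= a by rewrite /a; lra.
have b0 : 0 <= b by rewrite /b; lra.
have a2 : a <= 2^-1 by rewrite /a; lra.
have b2 : b <= 2^-1 by rewrite /b; lra.
pose d := a - b; pose e := a * b; pose u := c + 1.
have e0 : 0 <= e by exact: mulr_ge0.
have u0 : 0 <= u by rewrite /u; lra.
have ed1 : e <= 4^-1 - d / 2.
  have : 0 <= (2^-1 - a) * b + (2^-1 - a) / 2 by rewrite addr_ge0 ?mulr_ge0 //; lra.
  by rewrite /e /d; lra.
have ed2 : e <= 4^-1 + d / 2.
  have : 0 <= (2^-1 - b) * a + (2^-1 - b) / 2 by rewrite addr_ge0 ?mulr_ge0 //; lra.
  by rewrite /e /d; lra.
have d1 : - 2^-1 <= d by rewrite /d; lra.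
have d2 : d <= 2^-1 by rewrite /d; lra.
pose A2 := 3 / 2 - 6 * e.
pose B := e * (10 + 4 * d) - (3 / 2 + 3 * d).
pose N1 := (2^-1 + a) * (2^-1 - b) * (3 / 2 + 3 * d - 2 * e).
pose Q := 9 / 4 + 3 * d - 3 * d ^+ 2 - e * (10 - 4 * d + 4 * d ^+ 2) - 12 * e ^+ 2.
have NE : quad3 al be c = A2 * u ^+ 2 + B * u + N1.
  by rewrite /quad3 /A2 /B /N1 /u /e /d /a /b; field.
have A20 : 0 <= A2 by rewrite /A2; lra.
have N10 : 0 <= N1 by rewrite /N1 !mulr_ge0 //; lra.
(* Either the quadratic increases on [-1, 1], or its discriminant - 4 e Q is
   nonpositive. *)
have [B0|B0] := lerP 0 B.
  by rewrite NE addr_ge0 // addr_ge0 // mulr_ge0 // exprn_ge0.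
(* A2 = 0 would force e = 1/4 and d = 0, whence B = 1, against B < 0. *)
have A2p : 0 < A2.
  rewrite /A2; have [d0|d0] := lerP 0 d; last by lra.
  rewrite lt_neqAle A20 andbT; apply/eqP => E.
  have e4 : e = 4^-1 by move: E; rewrite /A2; lra.
  have d00 : d = 0 by lra.
  by move: B0; rewrite /B e4 d00; lra.
have Q0 : 0 <= Q.
  have k0 : 0 < 10 + 4 * d by lra.
  rewrite -(pmulr_lge0 _ k0).
  (* The factor 10 + 4 d is the coefficient of e in B. Eliminating with B isolates a term in - B,
     which has the favourable sign. *)
  have E : Q * (10 + 4 * d) = (1 + 2 * d) * (15 / 2 - 12 * d ^+ 2 - 18 * e)
     - B * (10 - 4 * d + 4 * d ^+ 2 + 12 * e).
    by rewrite /Q /B; field.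
  rewrite E subr_ge0; apply: (le_trans (y := 0)).
    rewrite nmulr_rle0 //; nra.
  have [d0|d0] := lerP 0 d; first by rewrite mulr_ge0 //; nra.
  have ek : e * (10 + 4 * d) <= 3 / 2 + 3 * d by rewrite -subr_le0 ltW.
  have e8 : 8 * e <= 3 / 2 + 3 * d.
    apply: le_trans ek; rewrite mulrC ler_wpM2l //; lra.
  have dd : d ^+ 2 <= - d / 2.
    have : 0 <= - d * (d + 2^-1) by rewrite mulr_ge0 //; lra.
    by rewrite expr2; lra.
  by rewrite mulr_ge0 //; lra.
rewrite NE -(pmulr_rge0 _ (_ : 0 < 4 * A2)); last by rewrite mulr_gt0.
have -> : 4 * A2 * (A2 * u ^+ 2 + B * u + N1) = (2 * A2 * u + B) ^+ 2 + 4 * e * Q.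
  by rewrite /A2 /B /N1 /Q /e /d; field.
by rewrite addr_ge0 ?sqr_ge0 // mulr_ge0 // mulr_ge0.
Qed.

End QuadraticFactor.

(** * The cases p = 1, 2, 3 *)

Section Cases.
Variable R : realType.
Implicit Types (q m n k p : nat).

Lemma sum_lcos_orth q n k : (n < k)%N -> (n + k < q)%N ->
  \sum_(0 <= m < q) lcos R q (m * n) * lcos R q (m * k) = 0.
Proof.
move=> nk nkq; rewrite sum_lcosM; last by lia.
by rewrite !gtnNdvd ?add0r ?mul0r //; lia.
Qed.

Lemma sum_lcos0 q k : (0 < k < q)%N -> \sum_(0 <= m < q) lcos R q (m * k) = 0.
Proof. by move=> kq; rewrite sum_lcos ?gtnNdvd //; lia. Qed.

Lemma sum_lcos1 q : (1 < q)%N -> \sum_(0 <= m < q) lcos R q m = 0.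
Proof.
move=> q1; rewrite -[RHS](@sum_lcos0 q 1) //.
by apply: eq_bigr => m _; rewrite muln1.
Qed.

(** The weight is uniform and there are no nodes; T is the Fejer kernel normalized at 0. *)
Lemma extremal_p1 q : (2 <= q)%N ->
  [/\ delta R (K0 1 q) = 1 / q%:R, delta R (Kpq 1 q) = 1 / q%:R &
      turan_A (1%:R / q%:R : R) = 1 / q%:R].
Proof.
move=> q2; have q0 : (0 < q)%N by lia.
have [D [d Dh]] := hat_function_exists R q2.
pose mu (m : nat) : R := 1 / q%:R.
have qn : q%:R != 0 :> R by rewrite pnatr_eq0; lia.
have dw : dual_weight 1 q mu.
  split=> [m||k kq]; first by rewrite divr_ge0.
    by rewrite sumr_const_nat subn0 -[LHS]mulr_natr mul1r mulVf.
  by rewrite -mulr_sumr sum_lcos0 ?mulr0 //; lia.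
have [H [c [adm c0]]] : exists H c, admissible_poly (K0 1 q) H c /\ c 0%N = mu 0%N.
  apply: (@fejer_extremal R q [::] _ _ q0 1 (fun=> 0)) => //.
  - by rewrite size_poly1.
  - by move=> y _; rewrite -polyC1 hornerC.
  - by rewrite big_nil -polyC1 hornerC.
  - by move=> j /=; lia.
by apply: (extremal_values (v := 1 / q%:R) _ _ Dh dw _ adm) => //; lia.
Qed.

Lemma lcos_half_odd q : odd q -> lcos R q (q./2) = - cos (pi / q%:R).
Proof.
move=> oq; have qn : q%:R != 0 :> R by rewrite pnatr_eq0; lia.
have e : q%:R = 2 * (q./2)%:R + 1 :> R by rewrite -natrM natr1; congr (_%:R); lia.
rewrite /lcos (_ : 2 * pi * _ = - (pi / q%:R) + pi); first by rewrite cosDpi cosN.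
have -> : (q./2)%:R = (q%:R - 1) / 2 :> R by rewrite e; field.
by field.
Qed.

(** The only node is (q - 1)/2, where the cosine takes its least lattice value -g; hence 1 + cos/g
    is a nonnegative weight. *)
Lemma extremal_p2 q : (5 <= q)%N -> odd q ->
  let v : R := (1 + cos (pi / q%:R)) / (q%:R * cos (pi / q%:R)) in
  [/\ delta R (K0 2 q) = v, delta R (Kpq 2 q) = v & turan_A (2%:R / q%:R : R) = v].
Proof.
move=> q5 oq v; have q0 : (0 < q)%N by lia.
have q2 : (2 <= q)%N by lia.
have [D [d Dh]] := hat_function_exists R q2.
have qn : q%:R != 0 :> R by rewrite pnatr_eq0; lia.
pose r := q./2; pose g : R := cos (pi / q%:R).
have ar : lcos R q r = - g by exact: lcos_half_odd.
have g0 : 0 < g.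
  have qR : 2 < q%:R :> R by rewrite ltr_nat; lia.
  have qR0 : 0 < q%:R :> R by rewrite ltr0n.
  have pi0 := pi_gt0 R; apply: cos_gt0_pihalf; apply/andP; split.
    by apply: (lt_trans (y := 0)); [rewrite oppr_lt0 divr_gt0 | rewrite divr_gt0].
  by rewrite ltr_pM2l // ltf_pV2 ?posrE.
have g1 : g < 1.
  have rS s : s \in [:: r] -> (0 < s)%N /\ (2 * s < q)%N.
    by rewrite inE => /eqP ->; rewrite /r; lia.
  by have := lcos_lt1 R rS q0 (mem_head _ _); rewrite ar ltrN2 => /andP[].
have gn : g != 0 by rewrite gt_eqF.
pose mu m : R := q%:R^-1 * (1 + lcos R q m / g).
have dw : dual_weight 2 q mu.
  split=> [m||k kq].
  - have am : - g <= lcos R q m.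
      by rewrite -ar; have [m' m'q ->] := lcos_half R m q0; apply: ler_lcos; rewrite /r; lia.
    rewrite mulr_ge0 ?invr_ge0 // (_ : 1 + _ = (g + lcos R q m) / g); last by field.
    by rewrite divr_ge0 ?(ltW g0) //; lra.
  - rewrite -mulr_sumr big_split /= -mulr_suml sumr_const_nat subn0.
    by rewrite sum_lcos1 // mul0r addr0 mulVf.
  - rewrite (eq_bigr (fun m => q%:R^-1 * lcos R q (m * k) +
      (q%:R^-1 / g) * (lcos R q (m * 1) * lcos R q (m * k)))); last first.
      by move=> m _; rewrite /mu muln1; field; rewrite qn gn.
    rewrite big_split /= -!mulr_sumr sum_lcos0; last lia.
    by rewrite sum_lcos_orth ?mulr0 ?addr0 //; lia.
have mu0 : mu 0%N = v by rewrite /mu lcos0 /v -/g; field; rewrite qn gn.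
have gE : 1 + g != 0 by rewrite gt_eqF //; lra.
(* The line with value (1 + g)^2 at 1 and (1 + g)^2 (1 - g)/g at the node -g, the latter dictated by
   A = 1/(2g). *)
pose L : {poly R} := (1 + g) *: (('X - 1) * ((1 - 2 * g) / - g)%:P + (1 + g)%:P).
have LE y : L.[y] = (1 + g) * ((y - 1) * ((2 * g - 1) / g) + (1 + g)).
  rewrite hornerZ hornerD hornerM hornerD hornerN -polyC1 !hornerC hornerX.
  by field.
have rr : (0 < r)%N /\ (2 * r < q)%N by rewrite /r; lia.
have [H [c [adm c0]]] : exists H c, admissible_poly (K0 2 q) H c /\ c 0%N = mu 0%N.
  apply: (@fejer_extremal R q [:: r] _ _ q0 L (fun=> (2 * g)^-1)) => //.
  - by move=> s; rewrite inE => /eqP ->.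
  - by rewrite /=; lia.
  - rewrite (leq_trans (size_scale_leq _ _)) // (leq_trans (size_polyD _ _)) //.
    rewrite geq_max (leq_trans (size_polyC_leq1 _)) // andbT mulrC mul_polyC.
    by rewrite (leq_trans (size_scale_leq _ _)) // -polyC1 size_XsubC.
  - move=> y /andP[y1 y2]; rewrite LE mulr_ge0 //; first by lra.
    (* Convex combination of the values at y = 1 and y = -1. *)
    have -> : (y - 1) * ((2 * g - 1) / g) + (1 + g) =
      (1 + y) / 2 * (1 + g) + (1 - y) / 2 * ((1 - g) * (2 - g) / g) by field.
    by rewrite addr_ge0 // mulr_ge0 ?divr_ge0 ?mulr_ge0 //; lra.
  - by rewrite LE big_seq1 ar; field.
  - move=> s; rewrite inE => /eqP ->; rewrite LE ar big_cons eqxx big_nil /=.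
    by field.
  - move=> j j1; have -> : j = 1%N by move: j1 => /=; lia.
    by rewrite big_seq1 muln1 ar; field.
  - by move=> s; rewrite inE => /eqP ->; rewrite /mu lcosB ?ar ?mulNr ?divff ?subrr ?mulr0 //; lia.
by apply: (extremal_values (v := v) _ _ Dh dw _ adm) => //; rewrite ?c0 //; lia.
Qed.

(** Refining the lattice puts r/q on one grid with 1/3 or 1/4, so that cosines are compared through
    integers. *)
Lemma lcos_scale q m k : (0 < q)%N -> (0 < k)%N -> lcos R (k * q) (k * m) = lcos R q m.
Proof.
move=> q0 k0; rewrite /lcos !natrM; congr (cos (_ * _)).
have : q%:R != 0 :> R by rewrite pnatr_eq0; lia.
have : k%:R != 0 :> R by rewrite pnatr_eq0; lia.
by move=> kn qn; field; rewrite kn qn.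
Qed.

Lemma lcos_third q : (0 < q)%N -> lcos R (3 * q) q = - 2^-1.
Proof.
move=> q0; rewrite -{2}(muln1 q) mulnC lcos_scale //.
have := @sum_lcos1 3 isT; rewrite 2?big_nat_recl // big_nat1 lcos0.
by rewrite -(lcosB R (q := 3) (m := 1)) //= => h; lra.
Qed.

Lemma lcos_quarter q : (0 < q)%N -> lcos R (4 * q) q = 0.
Proof.
move=> q0; rewrite -{2}(muln1 q) mulnC lcos_scale // /lcos.
by rewrite (_ : 2 * pi * _ = pi / 2) ?cos_pihalf //; field.
Qed.

(** The nodes r and r + 1 are adjacent, so no lattice value of the cosine falls strictly between be
    and al, and the product defining mu is nonnegative. *)
Lemma extremal_p3 q (al be : R) : (7 <= q)%N -> ~~ (3 %| q)%N ->
  lcos R q (q %/ 3) = al -> lcos R q (q %/ 3).+1 = be ->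
  let v : R := 1 / q%:R * (1 + (1 - 2 * (al + be)) / (1 + 2 * al * be)) in
  [/\ delta R (K0 3 q) = v, delta R (Kpq 3 q) = v & turan_A (3%:R / q%:R : R) = v].
Proof.
move=> q7 q3 alE beE v; have q0 : (0 < q)%N by lia.
have q2 : (2 <= q)%N by lia.
have [D [d Dh]] := hat_function_exists R q2.
have qn : q%:R != 0 :> R by rewrite pnatr_eq0; lia.
have [r1 r2] : (3 * (q %/ 3) < q)%N /\ (q < 3 * (q %/ 3).+1)%N by lia.
move: (q %/ 3)%N r1 r2 alE beE => r r1 r2 alE beE {q3}.
have rq : (2 * r.+1 < q)%N by lia.
have rq' : (2 * r.+1 <= q)%N by lia.
have rq'' : (2 * r <= q)%N by lia.
have rS s : s \in [:: r; r.+1] -> (0 < s)%N /\ (2 * s < q)%N.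
  by rewrite !inE => /orP[]/eqP ->; lia.
have rq1 : (r <= q)%N by lia.
have rq2 : (r.+1 <= q)%N by lia.
have q20 : (0 < 2 < q)%N by lia.
have p6 : (2 * 3 <= q)%N by lia.
have kfacts k : (3 <= k <= q - 3)%N ->
  [/\ (0 < k < q)%N, (1 < k)%N, (2 < k)%N, (1 + k < q)%N & (2 + k < q)%N].
  by move=> kq; split; lia.
have rr : (r == r.+1) = false by apply/eqP; lia.
have rr' : (r.+1 == r) = false by apply/eqP; lia.
have j12 j : (0 < j <= 2)%N -> j = 1%N \/ j = 2%N by lia.
have al1 : - 2^-1 <= al.
  rewrite -(lcos_third q0) -alE -(@lcos_scale q _ 3) //; apply: ler_lcos; lia.
(* Here q >= 7 gives r >= 2, so q <= 3 r + 2 <= 4 r. *)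
have al2 : al <= 0.
  rewrite -(lcos_quarter q0) -alE -(@lcos_scale q _ 4) //; apply: ler_lcos; lia.
have be2 : be <= - 2^-1.
  rewrite -(lcos_third q0) -beE -(@lcos_scale q _ 3) //; apply: ler_lcos; lia.
have be1 : -1 <= be by rewrite -beE; exact: cos_geN1.
have albe : be < al by rewrite -alE -beE; apply: ltr_lcos; lia.
have e0 : 0 < 1 + 2 * al * be.
  have : 0 <= - al * - be by rewrite mulr_ge0 //; lra.
  by lra.
have en : 1 + 2 * al * be != 0 by rewrite gt_eqF.
have abn : al - be != 0 by rewrite gt_eqF // subr_gt0.
have al1n : 1 - al != 0 by rewrite gt_eqF //; lra.
have be1n : 1 - be != 0 by rewrite gt_eqF //; lra.
pose e : R := 1 + 2 * al * be.
pose mu m : R := q%:R^-1 * (2 / e) * ((lcos R q m - al) * (lcos R q m - be)).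
(* Only the frequencies 0, 1, 2 occur, which are orthogonal to 3, ..., q - 3; the factor 2/e makes
   the constant term 1/q. *)
have muE m : mu m = q%:R^-1 + q%:R^-1 * (- 2 * (al + be) / e) * lcos R q m
    + q%:R^-1 * (1 / e) * lcos R q (m * 2).
  rewrite /mu; have -> : lcos R q (m * 2) = 2 * lcos R q m ^+ 2 - 1.
    by rewrite lcos_sqr muln2 addnn; field.
  by rewrite /e; field; rewrite qn en.
have dw : dual_weight 3 q mu.
  split=> [m||k kq].
  - apply: mulr_ge0; first by rewrite mulr_ge0 ?divr_ge0 ?invr_ge0 ?(ltW e0).
    have [m' m'q ->] := lcos_half R m q0; have [mr|mr] := leqP m' r.
      have am : al <= lcos R q m' by rewrite -alE; exact: ler_lcos.
      by apply: mulr_ge0; lra.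
    have am : lcos R q m' <= be by rewrite -beE; exact: ler_lcos.
    by apply: mulr_le0; lra.
  - rewrite (eq_bigr _ (fun m _ => muE m)) 2!big_split /= -!mulr_sumr sum_lcos1 //.
    rewrite sum_lcos0 //.
    by rewrite sumr_const_nat subn0 !mulr0 !addr0 -[LHS]mulr_natr mulVf.
  - rewrite (eq_bigr (fun m => q%:R^-1 * lcos R q (m * k) +
       q%:R^-1 * (- 2 * (al + be) / e) * (lcos R q (m * 1) * lcos R q (m * k)) +
       q%:R^-1 * (1 / e) * (lcos R q (m * 2) * lcos R q (m * k)))); last first.
      by move=> m _; rewrite muE muln1 !mulrDl -!mulrA.
    have [k0 k1 k2 k1q k2q] := kfacts k kq.
    by rewrite 2!big_split /= -!mulr_sumr sum_lcos0 // !sum_lcos_orth // !mulr0 !addr0.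
have mu0 : mu 0%N = v.
  by rewrite /mu lcos0 /v /e; field; rewrite qn en.
(* Solution of the two moment equations, for j = 1 and j = 2. *)
pose A s : R := if s == r then - (2 * be + 1) * (1 - be) / (2 * (al - be) * e)
  else (2 * al + 1) * (1 - al) / (2 * (al - be) * e).
pose X b : {poly R} := 'X - b%:P.
pose L : {poly R} := ((1 - al) * (1 - be) / e) *: (e *: (X al * X be) +
  ((2 * be + 1) * (1 + al)) *: (X be * X 1) +
  ((2 * al + 1) * (1 + be)) *: (X al * X 1)).
have LE y : L.[y] = (1 - al) * (1 - be) / e * quad3 al be y.
  rewrite hornerZ !hornerD !hornerZ !hornerM !hornerXsubC /quad3 /e.
  by congr (_ * _); ring.
have sXX b c : (size (X b * X c)%R <= 3)%N.
  by rewrite (leq_trans (size_polyMleq _ _)) // !size_XsubC.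
have [H [c [adm c0]]] : exists H c, admissible_poly (K0 3 q) H c /\ c 0%N = mu 0%N.
  have e1 : e != 0 by [].
  apply: (@fejer_extremal R q [:: r; r.+1] _ _ q0 L A) => //.
  - by rewrite /= inE rr.
  - rewrite (leq_trans (size_scale_leq _ _)) // (leq_trans (size_polyD _ _)) // geq_max.
    rewrite (leq_trans (size_polyD _ _)) ?geq_max ?(leq_trans (size_scale_leq _ _)) //.
  - move=> y y1; rewrite LE mulr_ge0 ?divr_ge0 ?mulr_ge0 ?(ltW e0) //; try lra.
    by apply: quad3_ge0 => //; apply/andP.
  - rewrite LE /quad3 big_cons big_seq1 alE beE /e.
    by field.
  - move=> s; rewrite !inE => /orP[]/eqP ->; rewrite LE /A !big_cons big_nil.
      rewrite eqxx /= rr' /= alE beE /quad3 /e; field.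
      by rewrite abn en.
    rewrite eqxx /= rr rr' /= alE beE /quad3 /e; field.
    by rewrite abn en.
  - move=> j j1; rewrite big_cons big_seq1 /A eqxx rr'.
    have l2 n : lcos R q (n * 2) = 2 * lcos R q n ^+ 2 - 1.
      by rewrite lcos_sqr muln2 addnn; field.
    have [->|->] := j12 j j1.
      rewrite !muln1 alE beE /e; field; by rewrite abn en.
    rewrite !l2 alE beE /e; field; by rewrite abn en.
  - move=> s; rewrite !inE => /orP[]/eqP ->; rewrite /mu lcosB //.
      by rewrite alE subrr mul0r mulr0.
    by rewrite beE subrr !mulr0.
by apply: (extremal_values (v := v) _ _ Dh dw _ adm) => //; rewrite c0.
Qed.

End Cases.

(** * The case q = 2p + 1 *)

Section TwoFrequencies.
Variable R : realType.
Implicit Types (x y : R) (p q m n k : nat).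

(** Subtracting whole multiples of pi leaves a zero of sin in [0, pi), which can only be 0. *)
Lemma sin_eq0_nat y : sin y = 0 -> exists n : nat, `|y| = n%:R * pi.
Proof.
move=> sy; have pi0 := pi_gt0 R.
pose n := Num.truncn (`|y| / pi); exists n.
have yn : n%:R * pi <= `|y| < n%:R * pi + pi.
  have /andP[n1 n2] : n%:R <= `|y| / pi < n.+1%:R by apply: truncn_itv; rewrite divr_ge0 // ltW.
  rewrite -ler_pdivlMr // n1 /=.
  by move: n2; rewrite ltr_pdivrMr // -natr1 mulrDl mul1r.
have s0 : sin (`|y| - n%:R * pi) = 0.
  have sp : sin `|y| = 0 by case: ger0P; rewrite ?sinN sy ?oppr0.
  elim: (n) => [|k IH]; first by rewrite mul0r subr0.
  rewrite -[LHS]opprK -sinDpi -natr1 (_ : _ + pi = `|y| - k%:R * pi) ?IH ?oppr0 //; ring.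
have [/eqP|yn0] := eqVneq (`|y| - n%:R * pi) 0; first by rewrite subr_eq0 => /eqP.
have : 0 < sin (`|y| - n%:R * pi).
  by apply: sin_gt0_pi; case/andP: yn => y1 y2; rewrite lt_neqAle eq_sym yn0 /=; lra.
by rewrite s0 ltxx.
Qed.

Variable p : nat.
Hypothesis p0 : (0 < p)%N.
Let q := (2 * p + 1)%N.
Let g : R := cos (pi / q%:R).

Let q0 : (0 < q)%N. Proof. by rewrite /q; lia. Qed.

Let qR : q%:R = 2 * p%:R + 1 :> R. Proof. by rewrite /q natrD natrM. Qed.

Let lcos_p : lcos R q p = - g.
Proof.
rewrite -[RHS]lcos_half_odd; first by congr lcos; rewrite /q; lia.
by rewrite /q; lia.
Qed.

Let lcos_ge m : - g <= lcos R q m.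
Proof.
rewrite -lcos_p; have [m' m'q ->] := lcos_half R m q0.
by apply: ler_lcos; move: m'q; rewrite /q; lia.
Qed.

Lemma cos_pi_odd_bounds : 2^-1 <= g < 1.
Proof.
have q3 : (3 <= q)%N by rewrite /q; lia.
have pi0 := pi_gt0 R.
have b k : (3 <= k)%N -> pi / k%:R \in `[0, pi : R].
  move=> k3; rewrite in_itv /= divr_ge0 ?(ltW pi0) //=.
  by rewrite ler_pdivrMr ?ltr0n ?ler_peMr ?(ltW pi0) ?ler1n //; lia.
have z : 0 \in `[0, pi : R] by rewrite in_itv /= lexx ltW.
apply/andP; split.
  have -> : 2^-1 = cos (pi / 3%:R) :> R.
    by apply: oppr_inj; rewrite -(lcos_half_odd R (q := 3)) // -(lcos_third R (q := 1)).
  rewrite leNgt ltr_cos ?b // -leNgt ler_pM2l // lef_pV2 ?posrE ?ltr0n //.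
  by rewrite ler_nat.
by rewrite -(cos0 R) ltr_cos ?b // divr_gt0 // ltr0n.
Qed.

(** The weights p + 1 and p give both derivatives the amplitude 2 pi p (p + 1), so the derivative is
    a product of a sine and a cosine. *)
Definition two_cos x : R :=
  p.+1%:R * cos (2 * pi * p%:R * x) + p%:R * cos (2 * pi * p.+1%:R * x).

Lemma two_cosE x : two_cos x =
  p.+1%:R * cos (pi * q%:R * x - pi * x) + p%:R * cos (pi * q%:R * x + pi * x).
Proof.
by rewrite /two_cos qR -natr1; congr (_ * cos _ + _ * cos _); ring.
Qed.

Lemma is_derive_two_cos x : is_derive x 1 two_cos
  (- (4 * pi * p%:R * p.+1%:R) * (sin (pi * q%:R * x) * cos (pi * x))).
Proof.
apply: is_derive_eq (is_deriveD (is_deriveZ p.+1%:R (is_derive_cosM (2 * pi * p%:R) x))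
  (is_deriveZ p%:R (is_derive_cosM (2 * pi * p.+1%:R) x))) _.
have -> : 2 * pi * p%:R * x = pi * q%:R * x - pi * x by rewrite qR; ring.
have -> : 2 * pi * p.+1%:R * x = pi * q%:R * x + pi * x by rewrite qR -natr1; ring.
by rewrite sinB sinD /GRing.scale /=; ring.
Qed.

(** If the sine vanishes, |x| = n/q and the value is q times a lattice cosine, which is at least -g.
    If the cosine vanishes, the value is a product of two sines, at least -1, and q g >= 3/2. *)
Lemma two_cos_crit x : sin (pi * q%:R * x) * cos (pi * x) = 0 ->
  - (q%:R * g) <= two_cos x.
Proof.
have /andP[g1 g2] := cos_pi_odd_bounds.
have q1 : 3 <= q%:R :> R by rewrite ler_nat /q; lia.
move=> /eqP; rewrite mulf_eq0 => /orP[]/eqP h.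
  have -> : two_cos x = q%:R * cos (2 * pi * p%:R * x).
    have -> : 2 * pi * p%:R * x = pi * q%:R * x - pi * x by rewrite qR; ring.
    by rewrite two_cosE cosB cosD h qR -natr1; ring.
  rewrite -mulrN ler_pM2l ?ltr0n //.
  have [n] := sin_eq0_nat h; rewrite !normrM (ger0_norm (pi_ge0 R)) normr_nat => xn.
  have {}xn : `|x| = n%:R / q%:R.
    apply: (mulfI (x := pi * q%:R)); first by rewrite mulf_neq0 ?gt_eqF ?pi_gt0 ?ltr0n.
    by rewrite xn; field; rewrite pnatr_eq0 -lt0n.
  rewrite -cos_norm !normrM (ger0_norm (pi_ge0 R)) !normr_nat xn cos_lattE.
  exact: lcos_ge.
have -> : two_cos x = sin (pi * q%:R * x) * sin (pi * x).
  by rewrite two_cosE cosB cosD h -natr1; ring.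
apply: (le_trans (y := -1)); first by nra.
rewrite lerNl; apply: le_trans (ler_norm _) _; rewrite normrN normrM.
by rewrite mulr_ile1 // sin_max.
Qed.

(** A minimum over an interval with integer ends is either at an end, where the value is q, or at an
    interior critical point. *)
Lemma two_cos_ge x : - (q%:R * g) <= two_cos x.
Proof.
have /andP[g1 g2] := cos_pi_odd_bounds.
pose N : R := (Num.truncn `|x|).+1%:R.
have xN : `|x| < N by apply: truncnS_gt.
have N0 : 0 < N by exact: le_lt_trans xN.
have gN y : `|y| = N -> two_cos y = q%:R.
  move=> yN; rewrite /two_cos -(cos_norm (_ * p%:R * _)) -(cos_norm (_ * p.+1%:R * _)).
  rewrite !normrM (ger0_norm (pi_ge0 R)) !normr_nat yN /N -!(mulrA (2 * pi)) -!natrM.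
  rewrite -[2 * pi * _]add0r cosDnat2pi -[2 * pi * _]add0r cosDnat2pi cos0.
  by rewrite qR -natr1; ring.
have dE := is_derive_two_cos.
have cont : {within `[- N, N], continuous two_cos}.
  by apply: derivable_within_continuous => y _; case: (dE y).
have NN : - N <= N by lra.
have [c cN cmin] := EVT_min NN cont.
have xI : x \in `[- N, N] by rewrite in_itv /= -ler_norml ltW.
apply: le_trans (cmin x xI).
have [cb|cb] := eqVneq `|c| N.
  by rewrite (gN _ cb) (le_trans (y := 0)) // oppr_le0 mulr_ge0 //; lra.
have cI : c \in `]- N, N[.
  by rewrite in_itv /= -ltr_norml lt_neqAle cb ler_norml; move: cN; rewrite in_itv.
apply: two_cos_crit.
have dd y : y \in `]- N, N[ -> derivable two_cos y 1 by move=> _; case: (dE y).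
have cmin' y : y \in `]- N, N[ -> two_cos c <= two_cos y.
  by move=> /subset_itv_oo_cc; exact: cmin.
have d0 := @derive_val _ _ _ _ _ _ _ (derive1_at_min NN dd cI cmin').
have d1 := @derive_val _ _ _ _ _ _ _ (dE c).
have k0 : - (4 * pi * p%:R * p.+1%:R) != 0 :> R.
  by rewrite oppr_eq0 gt_eqF // !mulr_gt0 ?pi_gt0 ?ltr0n.
by move/eqP: d1; rewrite d0 eq_sym mulf_eq0 (negPf k0) => /eqP.
Qed.

(** [K0] is {p, p + 1}, and both frequencies have cosine -g at the lattice point 1. The weight (v, 1
    - v) on {0, 1} thus needs v = (1 - v) g, the same equation that makes the lower bound of T equal
    to 0. *)
Lemma extremal_odd : let v := g / (1 + g) in
  [/\ delta R (K0 p q) = v, delta R (Kpq p q) = v & turan_A (p%:R / q%:R : R) = v].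
Proof.
move=> v; have /andP[g1 g2] := cos_pi_odd_bounds.
have gn : 1 + g != 0 by rewrite gt_eqF //; lra.
have qn : q%:R != 0 :> R by rewrite pnatr_eq0 -lt0n.
have q2 : (2 <= q)%N by rewrite /q; lia.
have [D [d Dh]] := hat_function_exists R q2.
have v0 : 0 <= v by rewrite divr_ge0 //; lra.
have v1E : 1 - v = (1 + g)^-1 by rewrite /v; field.
have v1 : 0 <= 1 - v by rewrite v1E invr_ge0; lra.
pose mu m : R := if m == 0%N then v else if m == 1%N then 1 - v else 0.
have sum_mu (F : nat -> R) : \sum_(0 <= m < q) mu m * F m = v * F 0%N + (1 - v) * F 1%N.
  rewrite big_ltn // big_ltn // big1_seq /= ?addr0 ?addrA //.
  move=> m; rewrite mem_index_iota /= => /andP[m2 _].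
  by rewrite /mu !gtn_eqF ?mul0r //; lia.
have dw : dual_weight p q mu.
  split=> [m||k kq].
  - by rewrite /mu; case: ifP => // _; case: ifP.
  - under eq_bigr => m _ do rewrite -[mu m]mulr1.
    by rewrite sum_mu; ring.
  - rewrite sum_mu mul0n lcos0 mul1n.
    have -> : lcos R q k = - g.
      rewrite -lcos_p; have [->//|kp] := eqVneq k p.
      by rewrite -lcosB; [congr lcos| |]; move: kq kp; rewrite /q; lia.
    by rewrite v1E /v; field.
pose c k : R := if k == 0%N then v else
  if k == p then (1 - v) * p.+1%:R / q%:R else (1 - v) * p%:R / q%:R.
have TE x : cos_poly (K0 p q) q c x = v + (1 - v) / q%:R * two_cos x.
  rewrite /cos_poly; congr (_ + _); rewrite big_mkcond /=.
  rewrite (@big_cat_nat _ _ _ p) //=; last by rewrite /q; lia.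
  rewrite [X in X + _]big1_seq ?add0r => [|k]; last first.
    rewrite mem_index_iota => kp; case: ifP => //; rewrite K0P /q; lia.
  rewrite big_ltn; last by rewrite /q; lia.
  rewrite big_ltn; last by rewrite /q; lia.
  rewrite [X in _ + (_ + X)]big1_seq ?addr0 => [|k]; last first.
    rewrite mem_index_iota => kp; case: ifP => //; rewrite K0P /q; lia.
  rewrite !K0P !ifT; [|rewrite /q; lia|rewrite /q; lia].
  rewrite /c eqxx /two_cos !gtn_eqF //.
  by field.
have adm : admissible_poly (K0 p q) q c.
  split=> // [x|].
    rewrite TE; have B := two_cos_ge x.
    rewrite [X in 0 <= X + _](_ : v = (1 - v) / q%:R * (q%:R * g)).
      by rewrite -mulrDr mulr_ge0 ?divr_ge0 //; lra.
    by rewrite v1E /v; field; rewrite qn gn.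
  rewrite TE /two_cos !mulr0 cos0 qR -natr1.
  by field; rewrite -qR.
by apply: (extremal_values (v := v) _ _ Dh dw _ adm) => //; rewrite /q; lia.
Qed.

End TwoFrequencies.

Unset Implicit Arguments.
Set Strict Implicit.

Theorem theorem1 (R : realType) :
  [/\ (forall q : nat, (2 <= q)%N ->
         let v : R := 1 / q%:R in
         [/\ delta R (K0 1 q) = v,
             delta R (Kpq 1 q) = v &
             turan_A (1 / q%:R : R) = v]),
      (forall q : nat, (5 <= q)%N -> odd q ->
         let v : R := (1 + cos (pi / q%:R)) / (q%:R * cos (pi / q%:R)) in
         [/\ delta R (K0 2 q) = v,
             delta R (Kpq 2 q) = v &
             turan_A (2 / q%:R : R) = v]),
      (forall q : nat, (7 <= q)%N -> ~~ (3 %| q)%N ->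
         let r0 : nat := (q %/ 3)%N in
         let c0 : R := cos (2 * pi * r0%:R / q%:R) in
         let c1 : R := cos (2 * pi * (r0 + 1)%:R / q%:R) in
         let v : R :=
           1 / q%:R * (1 + (1 - 2 * (c0 + c1)) / (1 + 2 * c0 * c1)) in
         [/\ delta R (K0 3 q) = v,
             delta R (Kpq 3 q) = v &
             turan_A (3 / q%:R : R) = v]) &
      (forall p : nat, (1 <= p)%N ->
         let q : nat := (2 * p + 1)%N in
         let v : R := cos (pi / q%:R) / (1 + cos (pi / q%:R)) in
         [/\ delta R (K0 p q) = v,
             delta R (Kpq p q) = v &
             turan_A (p%:R / q%:R : R) = v])].

Proof.
split.
- by move=> q q2; exact: extremal_p1.
- by move=> q q5 oq; exact: extremal_p2.
- move=> q q7 q3 r0 c0 c1 v.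
  have latt n : lcos R q n = cos (2 * pi * n%:R / q%:R) by rewrite /lcos mulrA.
  by apply: extremal_p3 => //; rewrite latt // /c1 addn1.
- by move=> p p0 q v; exact: extremal_odd.
Qed.
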